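(* For $n\ge 2$, let $X_n$ be the number of left-to-right maxima of a permutation chosen uniformly at random among the permutations of length $n$ lying in $\bigcup_{p\ge 0}\mathcal{B}_p$ (equivalently, such a permutation lies in $\mathcal{B}_p$ with $p=n-1-X_n$). Then $\mathbb{E}[X_n]\sim \frac{\ln n}{\sqrt5}$ as $n\to\infty$, and $X_n$ has Gaussian fluctuations: $(X_n-\mathbb{E}[X_n])/\sqrt{\operatorname{Var}(X_n)}$ converges in distribution to the standard normal law. In particular the typical $p$ with the random permutation in $\mathcal{B}_p$ satisfies $p\sim n-\frac{\ln n}{\sqrt5}$.
   Context: A left-to-right maximum of $\sigma=\sigma_1\cdots\sigma_n$ is an entry $\sigma_i$ with $\sigma_k<\sigma_i$ for all $k<i$; other entries are non-left-to-right-maxima. A right-jump transforms $\sigma$ into $\sigma_1\cdots\sigma_{i-1}\sigma_{i+1}\cdots\sigma_j\sigma_i\sigma_{j+1}\cdots\sigma_n$ for some $1\le i<j\le n$. A permutation $\pi$ is a pattern of $\sigma$ if some subsequence of $\sigma$ is order-isomorphic to $\pi$. $\mathcal{C}_p$ is the set of permutations (of any length $n$) obtainable from the identity $12\cdots n$ by at most $p$ right-jumps; the basis $\mathcal{B}_p$ is the set of permutations not in $\mathcal{C}_p$ all of whose proper patterns lie in $\mathcal{C}_p$. A permutation in $\mathcal{B}_p$ has exactly $p+1$ non-left-to-right-maxima. *)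

(* Defs.v *)
From Stdlib Require Import Reals.
From mathcomp Require Import all_boot.

Set Implicit Arguments.
Unset Strict Implicit.
Unset Printing Implicit Defensive.

Definition is_perm (s : seq nat) : bool := perm_eq s (iota 1 (size s)).

Definition rjump (s : seq nat) (i j : nat) : seq nat :=
  take i s ++ drop i.+1 (take j.+1 s) ++ [:: nth 0 s i] ++ drop j.+1 s.

Inductive obtainable : nat -> seq nat -> Prop :=
| obt_id (p n : nat) : obtainable p (iota 1 n)
| obt_step (p : nat) (s : seq nat) (i j : nat) :
    obtainable p s -> i < j -> j < size s -> obtainable p.+1 (rjump s i j).

Definition inC (p : nat) (s : seq nat) : Prop := obtainable p s.

Definition order_iso (u t : seq nat) : Prop :=
  size u = size t /\
  forall i j, i < size u -> j < size u ->
    (nth 0 u i < nth 0 u j) = (nth 0 t i < nth 0 t j).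

Definition pattern (pi sigma : seq nat) : Prop :=
  exists u, subseq u sigma /\ order_iso u pi.

Definition basis (p : nat) (sigma : seq nat) : Prop :=
  is_perm sigma /\ ~ inC p sigma /\
  forall pi, is_perm pi -> size pi < size sigma -> pattern pi sigma -> inC p pi.

Definition lrmax (s : seq nat) : nat :=
  count (fun i => all (fun k => nth 0 s k < nth 0 s i) (iota 0 i)) (iota 0 (size s)).

Local Open Scope R_scope.

Definition sumR (f : seq nat -> R) (S : seq (seq nat)) : R :=
  foldr (fun s acc => f s + acc) 0 S.

(* Uniform distribution on the finite list S (without duplicates). *)
Definition meanX (S : seq (seq nat)) : R :=
  sumR (fun s => INR (lrmax s)) S / INR (size S).

Definition varX (S : seq (seq nat)) : R :=
  sumR (fun s => (INR (lrmax s) - meanX S) ^ 2) S / INR (size S).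

Definition cdf_normalized (S : seq (seq nat)) (x : R) : R :=
  sumR (fun s => if Rle_dec ((INR (lrmax s) - meanX S) / sqrt (varX S)) x
                 then 1 else 0) S / INR (size S).

Definition gauss (t : R) : R := exp (- (t * t) / 2) / sqrt (2 * PI).

Definition is_RInt (f : R -> R) (a b v : R) : Prop :=
  exists pr : Riemann_integrable f a b, RiemannInt pr = v.

Definition std_normal_cdf_is (x v : R) : Prop :=
  exists F : R -> R, (forall a, is_RInt gauss a x (F a)) /\
    (forall eps, 0 < eps -> exists A, forall a, a <= A -> Rabs (F a - v) < eps).

(* Main.v *)
Require Import Defs.
From Stdlib Require Import Reals Lra.
From Stdlib Require List.
From Coquelicot Require Import Coquelicot.
From mathcomp Require Import all_boot all_algebra zify Rstruct.

(** A right-jump creates at most one new non-record, and a permutation with k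
    non-records is reached in k jumps, so a nonempty permutation lies in some
    basis iff deleting any entry destroys a non-record.  Building permutations
    by inserting the smallest value, the record polynomials S_n of these
    permutations and U_n of those failing the condition only at their first
    record satisfy U_(n+1) = (n-1) U_n + u S_n and S_(n+1) = U_n + n S_n.
    At u = -(1+t^2)/4 this system is diagonalised by 1 + it, and S_n vanishes
    iff the sum of the angles atan (t/(2j-1)), 0 < j < n, is a multiple of pi.
    Hence all roots but 0 are real and at most -1/4, so X_n - 1 is a sum of
    independent Bernoulli variables with parameters at most 4/5, and its variance
    is at least a fifth of its mean.  Diagonalising at u = 1 gives
    E X_n = ln n / sqrt 5 + O(1); the variance then tends to infinity and
    Stein's method yields the Gaussian limit. *)

Set Implicit Arguments.
Unset Strict Implicit.
Unset Printing Implicit Defensive.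

Local Open Scope nat_scope.

(** * Records and the basis *)

(** The step matrices of the recurrence are multiples of the identity plus one fixed 2 by 2 matrix
    with rows 0, u and 1, 1. They commute, so a single diagonalisation serves every n. The
    discriminant 1 + 4u is the source of the substitution -(1+t^2)/4, of the bound -1/4 on the roots
    and, at u = 1, of sqrt 5. No root is missed: a sum of n such angles tends to n pi/2 as t grows,
    so it attains k pi whenever 0 < 2k < n, and these roots together with 0 exhaust the degree.
    Stein's equation is solved for continuous ramps instead of indicators, because the derivative of
    the solution has to be Lipschitz. The Lipschitz constant may depend on the ramp, which is fixed
    before the variance grows. Outside a compact interval the solution is a multiple of the Mills
    ratio, hence the sharp tail bounds. *)

Fixpoint nrec (m : nat) (s : seq nat) : nat :=
  if s is x :: t then if m < x then (nrec x t).+1 else nrec m t else 0.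

Fixpoint nonrec (m : nat) (s : seq nat) : nat :=
  if s is x :: t then if m < x then nonrec x t else (nonrec m t).+1 else 0.

Definition runmax (m : nat) (s : seq nat) : nat := foldl maxn m s.

Lemma nonrec_nrec m s : nonrec m s + nrec m s = size s.
Proof. by elim: s m => //= x t IH m; case: ifP => _; rewrite ?addnS ?addSn IH. Qed.

(** The threshold [m] stands for the maximum of the entries already read; with it the count over
    positions can be peeled from the front. *)
Lemma count_lrmax m s :
  count (fun i => (m < nth 0 s i) && all (fun k => nth 0 s k < nth 0 s i) (iota 0 i))
    (iota 0 (size s)) = nrec m s.
Proof.
elim: s m => //= x t IH m.
rewrite -[1]addn0 iotaDl count_map andbT.
case: ltnP => hx; rewrite -IH; [congr S | rewrite add0n]; apply: eq_count => i /=.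
  rewrite -[1]addn0 iotaDl all_map.
  case: (ltnP x (nth 0 t i)) => hi /=; last by rewrite andbF.
  by rewrite (ltn_trans hx hi) /=; apply: eq_all.
rewrite -[1]addn0 iotaDl all_map.
case: (ltnP m (nth 0 t i)) => hi //=.
by rewrite (leq_ltn_trans hx hi) /=; apply: eq_all.
Qed.

Lemma lrmaxE s : all (leq 1) s -> lrmax s = nrec 0 s.
Proof.
move=> pos; rewrite -count_lrmax /lrmax; apply: eq_in_count => i.
by rewrite mem_iota add0n /= => hi; rewrite (allP pos) // mem_nth.
Qed.

Lemma is_perm_pos s : is_perm s -> all (leq 1) s.
Proof.
move=> h; apply/allP => x; rewrite (perm_mem h) mem_iota.
by case/andP.
Qed.

Lemma is_perm_uniq s : is_perm s -> uniq s.
Proof. by move=> h; rewrite (perm_uniq h) iota_uniq. Qed.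

Lemma is_permP s : is_perm s -> s =i iota 1 (size s).
Proof. exact: perm_mem. Qed.

Lemma is_permI s : uniq s -> {subset s <= iota 1 (size s)} -> is_perm s.
Proof.
move=> us sub; rewrite /is_perm; apply: uniq_perm (iota_uniq _ _) _ => //.
by case: (uniq_min_size us sub) => //; rewrite size_iota.
Qed.

Lemma nonrec_homo m m' s : m <= m' -> nonrec m s <= nonrec m' s.
Proof.
elim: s m m' => //= x t IH m m' le.
case: (ltnP m' x) => h; first by rewrite (leq_ltn_trans le h).
case: ltnP => _; last by rewrite ltnS; apply: IH.
by apply: leqW; apply: IH.
Qed.

Lemma nonrec_cat m s t : nonrec m (s ++ t) = nonrec m s + nonrec (runmax m s) t.
Proof.
elim: s m => //= x s IH m; rewrite /runmax /=.
by rewrite {2}/maxn; case: ltnP => h; rewrite IH.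
Qed.

Lemma runmax_ge m s : m <= runmax m s.
Proof.
elim: s m => //= x s IH m; rewrite /runmax /=.
by apply: leq_trans (IH _); rewrite leq_maxl.
Qed.

Lemma runmax_cat m s t : runmax m (s ++ t) = runmax (runmax m s) t.
Proof. by rewrite /runmax foldl_cat. Qed.

Lemma runmax_max m x s : runmax (maxn x m) s = maxn x (runmax m s).
Proof. by elim: s m => //= y s IH m; rewrite /runmax /= -maxnA; apply: IH. Qed.

Lemma runmax_insert m x s t : runmax m (s ++ x :: t) = maxn x (runmax m (s ++ t)).
Proof. by rewrite !runmax_cat -runmax_max {1}/runmax /= maxnC. Qed.

(** Moving [x] to the right spares every other record: the entries of [s] meet a threshold no higher
    than before, those of [t] the same one. Only [x] itself can stop being a record. *)
Lemma nonrec_delay m x s t :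
  nonrec m (s ++ x :: t) <= (nonrec m (x :: s ++ t)).+1.
Proof.
rewrite nonrec_cat /=; case: (ltnP m x) => [h | h].
  rewrite nonrec_cat.
  have -> : runmax x s = maxn x (runmax m s).
    by rewrite -runmax_max (maxn_idPl (ltnW h)).
  have := nonrec_homo s (ltnW h).
  by case: ltnP => h2; lia.
rewrite nonrec_cat.
case: ltnP => h2; last by lia.
by have := runmax_ge m s; lia.
Qed.

Lemma rjump_split s i j : i < j -> j < size s ->
  exists (A : seq nat) (x : nat) (B C : seq nat), [/\ s = A ++ x :: B ++ C & rjump s i j = A ++ B ++ x :: C].
Proof.
move=> ij js.
exists (take i s), (nth 0 s i), (drop i.+1 (take j.+1 s)), (drop j.+1 s); split=> //.
rewrite -{1}(cat_take_drop i s) (drop_nth 0) ?(ltn_trans ij) //; congr (_ ++ _ :: _).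
by rewrite -{1}(cat_take_drop j.+1 s) drop_cat size_takel // ltnS ij.
Qed.

Lemma inC_bound p s : inC p s -> is_perm s /\ nonrec 0 s <= p.
Proof.
elim=> {p s} [p n | p s i j _ [ps le] ij js].
  rewrite /is_perm size_iota perm_refl; split=> //.
  suff -> : forall m, nonrec m (iota m.+1 n) = 0 by [].
  by elim: n => //= n IH m; rewrite ltnS leqnn IH.
have [A [x [B [C [es ->]]]]] := rjump_split ij js.
rewrite es in ps le; split.
  have e : perm_eq (A ++ B ++ x :: C) (A ++ x :: B ++ C).
    by rewrite perm_cat2l perm_catC /= perm_cons perm_catC.
  rewrite /is_perm (perm_size e); exact: perm_trans e ps.
rewrite nonrec_cat; move: le; rewrite nonrec_cat.
by have := nonrec_delay (runmax 0 A) x B C; lia.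
Qed.

Lemma first_nonrec m s : 0 < nonrec m s ->
  exists (D : seq nat) (x : nat) (C : seq nat), [/\ s = D ++ x :: C, nonrec m D = 0 & x <= runmax m D].
Proof.
elim: s m => //= y t IH m; case: (ltnP m y) => h hpos.
  have [D [x [C [-> h1 h2]]]] := IH _ hpos.
  by exists (y :: D), x, C; split; rewrite //= ?h // /runmax /= (maxn_idPr (ltnW h)).
by exists [::], y, t; split.
Qed.

(** Without non-records [D] is increasing above [m], so [x] has a sorted place in it, and not at the
    end since [x] does not exceed the maximum. *)
Lemma insert_record m x (D : seq nat) : nonrec m D = 0 -> x \notin D -> m < x ->
  x <= runmax m D ->
  exists A B : seq nat, [/\ D = A ++ B, 0 < size B & nonrec m (A ++ x :: B) = 0].
Proof.
elim: D m => [|y D IH] m; first by move=> _ _ /[swap]; rewrite /runmax /=; lia.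
rewrite /= inE negb_or /runmax /=; case: ltnP => // my.
move=> h0 /andP[xy xD] mx hx.
have [lt | le] := ltnP x y.
  by exists [::], (y :: D); split; rewrite //= mx lt.
have [|A [B [-> hB e]]] := IH y h0 xD _ hx; first by lia.
by exists (y :: A), B; split; rewrite //= my.
Qed.

Lemma nonrec0_sorted m s : nonrec m s = 0 -> path ltn m s.
Proof. by elim: s m => //= x t IH m; case: ltnP => //= _ /IH. Qed.

(** A jump is undone: the first non-record goes back to its sorted place in the increasing prefix
    before it. Later entries still meet the same maximum, so exactly one non-record disappears. *)
Lemma inC_complete p s : is_perm s -> nonrec 0 s <= p -> inC p s.
Proof.
elim: p s => [|p IH] s ps le.
  have -> : s = iota 1 (size s); last by constructor.
  have h : nonrec 0 s = 0 by lia.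
  apply: (irr_sorted_eq ltn_trans ltnn) (is_permP ps).
    by have /path_sorted := nonrec0_sorted h.
  exact: iota_ltn_sorted.
have [h | h] := posnP (nonrec 0 s).
  have -> : s = iota 1 (size s); last by constructor.
  apply: (irr_sorted_eq ltn_trans ltnn) (is_permP ps).
    by have /path_sorted := nonrec0_sorted h.
  exact: iota_ltn_sorted.
have [D [x [C [es hD hx]]]] := first_nonrec h.
have us := is_perm_uniq ps.
have xD : x \notin D by move: us; rewrite es -cat_rcons cat_uniq rcons_uniq => /and3P[/andP[]].
have x0 : 0 < x by apply: (allP (is_perm_pos ps)); rewrite es mem_cat inE eqxx orbT.
have [A [B [eD hB e]]] := insert_record hD xD x0 hx.
have pe : perm_eq (A ++ x :: B ++ C) s.
  by rewrite es eD -catA perm_cat2l perm_sym perm_catC /= perm_cons perm_catC.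
have p' : is_perm (A ++ x :: B ++ C).
  rewrite /is_perm (perm_size pe); exact: perm_trans pe ps.
have e' : nonrec 0 s = (nonrec 0 (A ++ x :: B ++ C)).+1.
  rewrite es nonrec_cat hD -cat_cons catA nonrec_cat e runmax_insert -eD /=.
  by rewrite ltnNge hx /= (maxn_idPr hx).
have := IH _ p' ltac:(lia).
have -> : s = rjump (A ++ x :: B ++ C) (size A) (size A + size B).
  rewrite es eD /rjump take_size_cat // nth_cat ltnn subnn /=.
  have -> : take (size A + size B).+1 (A ++ x :: B ++ C) = A ++ x :: B.
    rewrite -cat_cons catA take_size_cat //.
    by rewrite size_cat /= addnS.
  have -> : drop (size A + size B).+1 (A ++ x :: B ++ C) = C.
    rewrite -cat_cons catA drop_size_cat //.
    by rewrite size_cat /= addnS.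
  have -> : drop (size A).+1 (A ++ x :: B) = B.
    by rewrite -cat1s catA drop_size_cat // size_cat addn1.
  by rewrite -catA.
move=> ho; apply: obt_step => //; first by lia.
by rewrite size_cat /= size_cat; lia.
Qed.

Lemma inCP p s : inC p s <-> is_perm s /\ nonrec 0 s <= p.
Proof. by split=> [/inC_bound | [] /inC_complete]; [ | apply]. Qed.

(** Dropping an entry can only lower the thresholds that later entries meet. *)
Lemma nonrec_subseq m (u s : seq nat) : subseq u s -> nonrec m u <= nonrec m s.
Proof.
elim: s m u => [|x s IH] m u; first by rewrite subseq0 => /eqP->.
have drp v : subseq v s -> nonrec m v <= nonrec m (x :: s).
  move=> /(IH m) h; apply: leq_trans h _ => /=.
  by case: ltnP => h; [apply: nonrec_homo; lia | lia].
case: u => [|y u] //=; case: eqP => [-> | _] hs; last exact: (drp (y :: u)).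
by case: ltnP => _; rewrite ?ltnS; apply: IH.
Qed.

Lemma order_iso_lrmax u t : order_iso u t -> lrmax u = lrmax t.
Proof.
case=> es h; rewrite /lrmax -es; apply: eq_in_count => i.
rewrite mem_iota add0n /= => hi; apply: eq_in_all => k.
rewrite mem_iota add0n /= => hk.
by apply: h; rewrite // (ltn_trans hk hi).
Qed.

(* Says that deleting the record [x], which follows the record [m], turns a
   non-record of the tail [t] into a record. *)
Fixpoint gap (m x : nat) (t : seq nat) : bool :=
  if t is y :: t' then (y < x) && ((m < y) || gap m x t') else false.

(** Only records are tested: deleting a non-record lowers the number of non-records anyway. *)
Fixpoint good (m : nat) (s : seq nat) : bool :=
  if s is x :: t then if m < x then gap m x t && good x t else good m t else true.

(** The witness lies strictly between [m] and [x], before any entry exceeds [x]: a non-record behind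
    [x], a record behind [m]. After it the threshold without [x] is still the lower one. *)
Lemma gap_nonrec_lt m x t : m < x -> gap m x t -> nonrec m t < nonrec x t.
Proof.
move=> mx; elim: t => //= y t IH /andP[yx].
case: (ltnP m y) => [h _ | h /= /IH]; last by case: (ltnP x y); lia.
have -> : x < y = false by lia.
by rewrite ltnS; apply: nonrec_homo; lia.
Qed.

Lemma gapN_nonrec m x (t : seq nat) : m < x -> x \notin t -> ~~ gap m x t ->
  nonrec m t = nonrec x t.
Proof.
move=> mx; elim: t => //= y t IH; rewrite inE negb_or => /andP[xy xt].
case: (ltnP y x) => /= h.
  rewrite negb_or -leqNgt => /andP[ym g].
  have -> : m < y = false by lia.
  have -> : x < y = false by lia.
  by rewrite IH.
move=> _.
have -> : m < y by lia.
by have -> : x < y by lia.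
Qed.

Lemma goodN_delete m (s : seq nat) : uniq s -> ~~ good m s ->
  exists (A : seq nat) (x : nat) (B : seq nat), s = A ++ x :: B /\ nonrec m (A ++ B) = nonrec m s.
Proof.
elim: s m => //= y t IH m /andP[yt ut]; case: ltnP => h.
  rewrite negb_and; case g: (gap m y t) => /=; last first.
    by exists [::], y, t; split=> //=; apply: gapN_nonrec => //; rewrite g.
  move=> /(IH _ ut)[A [x [B [-> e]]]].
  by exists (y :: A), x, B; split=> //=; rewrite h.
move=> /(IH _ ut)[A [x [B [-> e]]]]; exists (y :: A), x, B; split=> //=.
by rewrite ltnNge h /= e.
Qed.

Lemma good_delete m A x B : good m (A ++ x :: B) ->
  nonrec m (A ++ B) < nonrec m (A ++ x :: B).
Proof.
elim: A m => [|y A IH] m /=.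
  case: ltnP => // h /andP[g _]; exact: gap_nonrec_lt.
by case: ltnP => // h; [case/andP=> _ | rewrite ltnS]; apply: IH.
Qed.

(** Reduces minimality, which ranges over all proper patterns, to deletions of a single entry. *)
Lemma subseq_proper (u s : seq nat) : subseq u s -> size u < size s ->
  exists (A : seq nat) (x : nat) (B : seq nat), s = A ++ x :: B /\ subseq u (A ++ B).
Proof.
elim: s u => [|x s IH] u //=; case: u => [|y u] /= hs lt.
  by exists [::], x, s; rewrite sub0seq.
move: hs; case: eqP => [e | _] hs; last by exists [::], x, s.
have [A [z [B [-> hu]]]] := IH _ hs lt.
by exists (x :: A), z, B; split=> //=; rewrite e eqxx.
Qed.

Lemma delete_pattern (A : seq nat) x B : is_perm (A ++ x :: B) ->
  exists pi : seq nat, [/\ is_perm pi, size pi = size (A ++ B) & order_iso (A ++ B) pi].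
Proof.
move=> ps; pose d y := if y < x then y else y.-1.
have us := is_perm_uniq ps.
have pe : perm_eq (A ++ x :: B) (x :: A ++ B) by rewrite perm_catC /= perm_cons perm_catC.
move: (us); rewrite (perm_uniq pe) /= => /andP[xn uAB].
have neq y : y \in A ++ B -> y != x by apply: contraTneq => ->.
have mono y z : y \in A ++ B -> z \in A ++ B -> (d y < d z) = (y < z).
  by move=> /neq hy /neq hz; rewrite /d; case: (ltnP y x); case: (ltnP z x); lia.
have rng y : y \in x :: A ++ B -> 0 < y <= (size (A ++ B)).+1.
  by rewrite -(perm_mem pe) (is_permP ps) (perm_size pe) mem_iota /=; lia.
exists (map d (A ++ B)); split; last 2 first.
- by rewrite size_map.
- split=> [|i j hi hj]; first by rewrite size_map.
  by rewrite !(nth_map 0) // mono // mem_nth.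
apply: is_permI.
  rewrite map_inj_in_uniq // => y z hy hz e.
  have := mono _ _ hy hz; have := mono _ _ hz hy; rewrite e !ltnn; lia.
move=> y /mapP[z hz ->]; rewrite size_map mem_iota.
have := rng z; rewrite inE hz orbT => /(_ isT).
have := rng x; rewrite inE eqxx => /(_ isT).
by have := neq _ hz; rewrite /d; case: (ltnP z x); lia.
Qed.

Lemma lrmax_subseq_perm (u s : seq nat) : is_perm s -> subseq u s -> lrmax u = nrec 0 u.
Proof.
move=> /is_perm_pos ps us; apply: lrmaxE; apply/allP => x /(mem_subseq us).
exact: (allP ps).
Qed.

(** Order isomorphism preserves the size and the number of records, hence the number of non-records,
    which decides membership in [inC]. The level of a good permutation is one less than that number.
    The empty permutation is excluded since it lies in every class. *)
Lemma basisP s : (exists p, basis p s) <-> [/\ is_perm s, 0 < size s & good 0 s].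
Proof.
split=> [[p [ps [nC mn]]] | [ps s0 gs]].
  have nl : p < nonrec 0 s by rewrite ltnNge; apply/negP => h; apply: nC; apply/inCP.
  split=> //.
    by case: (s) nl.
  apply/negPn/negP => /(goodN_delete (is_perm_uniq ps))[A [x [B [es e]]]].
  rewrite es in ps.
  have [pi [ppi spi iso]] := delete_pattern ps.
  have sub : subseq (A ++ B) (A ++ x :: B).
    by rewrite -cat1s catA; apply: cat_subseq => //; apply: prefix_subseq.
  have /inCP[_] : inC p pi.
    apply: mn => //; first by rewrite es spi !size_cat /= addnS.
    by exists (A ++ B); rewrite es.
  have := nonrec_nrec 0 pi; have := nonrec_nrec 0 (A ++ B).
  rewrite spi -(lrmaxE (is_perm_pos ppi)) -(order_iso_lrmax iso).
  by rewrite (lrmax_subseq_perm ps sub); lia.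
(* Deleting the first entry strictly lowers the number of non-records, which is therefore
   positive. *)
have npos : 0 < nonrec 0 s.
  case: s ps s0 gs => // x t ps _ /(@good_delete 0 [::]); exact: leq_ltn_trans.
exists (nonrec 0 s).-1; split=> //; split.
  by move/inCP => [_]; lia.
move=> pi ppi lt [u [us iso]]; apply/inCP; split=> //.
have su : size u = size pi by case: iso.
have [|A [x [B [es hu]]]] := subseq_proper us; first by rewrite su.
rewrite es in gs; have := good_delete gs; rewrite -es.
have : nonrec 0 u <= nonrec 0 (A ++ B) := nonrec_subseq 0 hu.
have := nonrec_nrec 0 pi; have := nonrec_nrec 0 u.
rewrite -su -(lrmaxE (is_perm_pos ppi)) -(order_iso_lrmax iso).
rewrite (lrmax_subseq_perm ps us) => h1 h2 h3 h4.
rewrite -ltnS (prednK npos); apply: leq_ltn_trans h4; apply: leq_trans h3.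
by rewrite leq_eqVlt -(eqn_add2r (nrec 0 u)) h1 h2 eqxx.
Qed.

(** * Insertion of the smallest value *)

Definition ins_at (i : nat) (t : seq nat) : seq nat := take i t ++ 1 :: drop i t.

Lemma nrec_ins_at m i t : 0 < m -> nrec m (ins_at i t) = nrec m t.
Proof.
move=> m0; have h1 u k : 0 < k -> nrec k (1 :: u) = nrec k u by move=> k0; rewrite /= ltnNge k0.
elim: t i m m0 => [|y t IH] [|i] m m0; rewrite /ins_at ?h1 //=.
rewrite -!/(ins_at _ _); case: (ltnP m y) => h; rewrite IH //.
exact: leq_trans h.
Qed.

Lemma gap_ins_at m x i t : 0 < m -> 1 < x -> gap m x (ins_at i t) = gap m x t.
Proof.
move=> m0 x1; have h1 u : gap m x (1 :: u) = gap m x u.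
  by rewrite /= x1 ltnNge m0.
elim: t i => [|y t IH] [|i]; rewrite /ins_at ?h1 //=.
by rewrite -!/(ins_at _ _) IH.
Qed.

Lemma good_ins_at m i t : 0 < m -> good m (ins_at i t) = good m t.
Proof.
move=> m0; have h1 u k : 0 < k -> good k (1 :: u) = good k u by move=> k0; rewrite /= ltnNge k0.
elim: t i m m0 => [|y t IH] [|i] m m0; rewrite /ins_at ?h1 //=.
rewrite -!/(ins_at _ _); case: (ltnP m y) => h; rewrite IH ?gap_ins_at //; first by lia.
exact: leq_trans h.
Qed.

Lemma nrec_shift m t : nrec m.+1 (map S t) = nrec m t.
Proof. by elim: t m => //= y t IH m; rewrite ltnS !IH. Qed.

Lemma gap_shift m x t : gap m.+1 x.+1 (map S t) = gap m x t.
Proof. by elim: t => //= y t ->. Qed.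

Lemma good_shift m t : good m.+1 (map S t) = good m t.
Proof. by elim: t m => //= y t IH m; rewrite ltnS !IH gap_shift. Qed.

(** The smallest value is a record only in front and hides no larger entry, so all old records
    survive its insertion. *)
Definition ins (i : nat) (s : seq nat) : seq nat := ins_at i (map S s).

Fixpoint perms (n : nat) : seq (seq nat) :=
  if n is n'.+1 then [seq ins i s | s <- perms n', i <- iota 0 n'.+1] else [:: [::]].

Lemma ins_perm i s : is_perm s -> is_perm (ins i s) /\ size (ins i s) = (size s).+1.
Proof.
move=> ps; have sz : size (ins i s) = (size s).+1.
  by rewrite /ins /ins_at size_cat /= addnS -size_cat cat_take_drop size_map.
split=> //; rewrite /is_perm sz /ins /ins_at perm_catC /= perm_cons perm_catC cat_take_drop.
by rewrite (iotaDl 1 1); apply: perm_map.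
Qed.

Lemma index_ins i s : all (leq 1) s -> i <= size s -> index 1 (ins i s) = i.
Proof.
rewrite /ins => ps; have : 1 \notin map S s.
  by apply/mapP => -[x /(allP ps) /[swap] -[<-]].
rewrite -(size_map S s); move: (map S s) => t h1 h2; rewrite /ins_at index_cat.
rewrite (negbTE (contra (@mem_take _ _ _ _) h1)) size_takel //= addn0 //.
Qed.

Lemma ins_inj i j s t : all (leq 1) s -> all (leq 1) t -> i <= size s -> j <= size t ->
  ins i s = ins j t -> i = j /\ s = t.
Proof.
move=> ps pt si st e; have eij : i = j by rewrite -(index_ins ps si) e index_ins.
split=> //; subst j; apply: (inj_map succn_inj).
have /eqP : ins i s = ins i t by [].
rewrite /ins /ins_at eqseq_cat ?size_takel ?size_map //= eqseq_cons => /andP[/eqP e1 /andP[_ /eqP e2]].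
by rewrite -[LHS](cat_take_drop i) e1 e2 cat_take_drop.
Qed.

Lemma ins_surj s n : is_perm s -> size s = n.+1 ->
  exists t i, [/\ is_perm t, size t = n, i <= n & s = ins i t].
Proof.
move=> ps sz; have us := is_perm_uniq ps.
have s1 : 1 \in s by rewrite (is_permP ps) sz mem_iota; lia.
have es : s = take (index 1 s) s ++ 1 :: drop (index 1 s).+1 s.
  by rewrite -{1}(cat_take_drop (index 1 s) s) (drop_nth 0) ?index_mem // nth_index.
set i := index 1 s in es; pose r := take i s ++ drop i.+1 s.
have pr : perm_eq s (1 :: r) by rewrite {1}es perm_catC /= perm_cons perm_catC.
have pr2 : perm_eq r (iota 2 n).
  have : perm_eq (1 :: r) (iota 1 (size s)).
    by apply: perm_trans ps; rewrite perm_sym.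
  by rewrite sz /= perm_cons.
have er : map S (map predn r) = r.
  rewrite -map_comp; apply: map_id_in => y; rewrite (perm_mem pr2) mem_iota /=; lia.
have sr : size r = n by rewrite (perm_size pr2) size_iota.
have si : i <= n by rewrite -ltnS -sz index_mem.
exists (map predn r), i; split=> //; rewrite ?size_map //.
  rewrite /is_perm size_map sr.
  have -> : iota 1 n = map predn (iota 2 n).
    by rewrite (iotaDl 1 1) -map_comp map_id_in.
  exact: perm_map.
by rewrite /ins er /ins_at /r take_size_cat ?drop_size_cat // size_takel ?sz // ltnW.
Qed.

Lemma mem_perms n s : (s \in perms n) = is_perm s && (size s == n).
Proof.
elim: n s => [|n IH] s.
  by rewrite inE size_eq0; case: eqP => [->|]; rewrite ?andbF.
apply/allpairsP/andP => [[[t i] /=]|[ps /eqP sz]].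
  rewrite IH => -[/andP[pt /eqP st] _ ->].
  by have [-> ->] := ins_perm i pt; rewrite st.
have [t [i [pt st hi ->]]] := ins_surj ps sz.
exists (t, i); split=> //; first by rewrite IH pt st eqxx.
by rewrite (mem_iota 0 n.+1).
Qed.

Lemma perms_uniq n : uniq (perms n).
Proof.
elim: n => //= n IH.
apply: (@allpairs_uniq _ _ _ (fun s i => ins i s)) (iota_uniq 0 n.+1) _ => // -[s i] [t j].
move=> /allpairsP h1 /allpairsP h2.
case: h1 => -[s' i'] [hs hi [-> ->]]; case: h2 => -[t' j'] [ht hj [-> ->]].
move: hs ht => /=; rewrite !mem_perms => /andP[ps /eqP ss] /andP[pt /eqP st].
move: hi hj; rewrite !mem_iota /= add0n !ltnS => hi hj.
case/(ins_inj (is_perm_pos ps) (is_perm_pos pt)); rewrite ?ss ?st //.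
by move=> -> ->.
Qed.

Local Open Scope R_scope.

(** * Finite sums over lists of permutations *)

Lemma sumR_cat f s t : sumR f (s ++ t) = sumR f s + sumR f t.
Proof. by elim: s => /= [|x s ->]; ring. Qed.

Lemma sumR_eq f g s : {in s, forall x, f x = g x} -> sumR f s = sumR g s.
Proof.
elim: s => //= x s IH h; rewrite IH ?h ?mem_head // => y hy.
by apply: h; rewrite inE hy orbT.
Qed.

Lemma sumR_allpairs (f : seq nat -> R) (h : nat -> seq nat -> seq nat) s (t : seq nat) :
  sumR f [seq h i x | x <- s, i <- t] = sumR (fun x => sumR f [seq h i x | i <- t]) s.
Proof. by elim: s => //= x s IH; rewrite sumR_cat IH. Qed.

Lemma sumR_const f (c : R) s : {in s, forall x, f x = c} -> sumR f s = INR (size s) * c.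
Proof.
elim: s => [|x s IH] h; first by rewrite /=; ring.
have hx := h x (mem_head x s).
have {}IH : sumR f s = INR (size s) * c.
  by apply: IH => y hy; apply: h; rewrite inE hy orbT.
by rewrite -[sumR f (x :: s)]/(f x + sumR f s) -[size (x :: s)]/(size s).+1 S_INR IH hx; ring.
Qed.

Lemma sumR_add f g s : sumR (fun x => f x + g x) s = sumR f s + sumR g s.
Proof. by elim: s => /= [|x s ->]; ring. Qed.

Lemma sumR_scal (c : R) f s : sumR (fun x => c * f x) s = c * sumR f s.
Proof. by elim: s => /= [|x s ->]; ring. Qed.

Lemma sumR_filter f (P : pred (seq nat)) s :
  sumR f (filter P s) = sumR (fun x => if P x then f x else 0) s.
Proof. by elim: s => //= x s IH; case: (P x); rewrite /= IH; ring. Qed.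

Lemma sumR_perm f s t : perm_eq s t -> sumR f s = sumR f t.
Proof.
elim: s t => [|x s IH] t p; first by move: p; rewrite perm_sym => /perm_nilP ->.
have xt : x \in t by rewrite -(perm_mem p) mem_head.
have rem_sum : forall u, x \in u -> sumR f u = f x + sumR f (rem x u).
  elim=> //= y u IHu; rewrite inE eq_sym; case: eqP => [-> // | _ /IHu ->] /=; ring.
rewrite (rem_sum t xt) -(IH (rem x t)) //.
by rewrite -(perm_cons x); apply: perm_trans p _; apply: perm_to_rem.
Qed.

(* Only the first record can fail the gap condition in [wbad]; inserting smaller
   values cannot repair a later record. *)
Definition wgood (g : nat -> R) (s : seq nat) : R := if good 0 s then g (nrec 0 s) else 0.

Definition wbad (g : nat -> R) (s : seq nat) : R :=
  if s is x :: t then if ~~ gap 0 x t && good x t then g (nrec 0 s) else 0 else 0.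

Lemma ins0 s : ins 0 s = 1%nat :: map S s.
Proof. by rewrite /ins /ins_at take0 drop0. Qed.

Lemma insS i x t : ins i.+1 (x :: t) = x.+1 :: ins_at i (map S t).
Proof. by []. Qed.

Lemma nrec_ins i x t : (0 < x)%N ->
  nrec 0 (ins i.+1 (x :: t)) = nrec 0 (x :: t).
Proof. by move=> x0; rewrite insS /= nrec_ins_at // nrec_shift x0. Qed.

Section InsertionSums.
Variables (x : nat) (t : seq nat) (g : nat -> R).
Hypotheses (x0 : (0 < x)%N) (t0 : all (leq 1) t).

Let s := x :: t.

Lemma wgood_ins0 : wgood g (ins 0 s) = 0.
Proof. by rewrite ins0 /wgood /=. Qed.

(** A leading 1 is followed by a larger entry, so its gap fails, while the old first record now sits
    behind threshold 1 as it did behind 0. The new record is the factor u. *)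
Lemma wbad_ins0 : wbad g (ins 0 s) = wgood (fun k => g k.+1) s.
Proof.
rewrite ins0 /wbad /wgood /= gap_shift good_shift ltnS x0.
by rewrite /= nrec_shift; case: ifP.
Qed.

(** Right behind the first record, the value 1 would become a record if that record were deleted;
    the gap condition now holds whether or not it did before. *)
Lemma wgood_ins1 : wgood g (ins 1 s) = wgood g s + wbad g s.
Proof.
rewrite /wgood /wbad nrec_ins // insS /= x0 good_ins_at // good_shift.
rewrite {1}/ins_at take0 drop0 /= ltnS x0 /=.
by case: (gap 0 x t); case: (good x t) => /=; lra.
Qed.

Lemma wbad_ins1 : wbad g (ins 1 s) = 0.
Proof. by rewrite /wbad insS /ins_at take0 drop0 /= ltnS x0. Qed.

(** At threshold 0 the gap is decided by the first entry of the tail, which an insertion further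
    right leaves in place. *)
Lemma gap0_ins i : (i < size t)%N -> gap 0 x.+1 (ins_at i.+1 (map S t)) = gap 0 x t.
Proof.
case: t t0 => //= y t' /andP[y0 _] _.
by rewrite /ins_at /= ltnS y0.
Qed.

Lemma wgood_insSS i : (i < size t)%N -> wgood g (ins i.+2 s) = wgood g s.
Proof.
move=> hi; rewrite /wgood nrec_ins // insS /= x0 gap0_ins //.
by rewrite good_ins_at // good_shift.
Qed.

Lemma wbad_insSS i : (i < size t)%N -> wbad g (ins i.+2 s) = wbad g s.
Proof.
move=> hi; rewrite /wbad insS gap0_ins // -insS nrec_ins //.
by rewrite good_ins_at // good_shift.
Qed.

Lemma wgood_ins_sum : sumR (wgood g) [seq ins i s | i <- iota 0 (size s).+1] =
  wbad g s + INR (size s) * wgood g s.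
Proof.
rewrite -[LHS]/(wgood g (ins 0 s) + (wgood g (ins 1 s) +
  sumR (wgood g) [seq ins i s | i <- iota 2 (size t)])) wgood_ins0 wgood_ins1.
rewrite (@sumR_const _ (wgood g s)); last first.
  move=> u /mapP[i]; rewrite mem_iota => hi ->.
  by case: i hi => [|[|i]] // hi; apply: wgood_insSS; lia.
by rewrite size_map size_iota -[size s]/(size t).+1 S_INR; ring.
Qed.

Lemma wbad_ins_sum : sumR (wbad g) [seq ins i s | i <- iota 0 (size s).+1] =
  INR (size t) * wbad g s + wgood (fun k => g k.+1) s.
Proof.
rewrite -[LHS]/(wbad g (ins 0 s) + (wbad g (ins 1 s) +
  sumR (wbad g) [seq ins i s | i <- iota 2 (size t)])) wbad_ins0 wbad_ins1.
rewrite (@sumR_const _ (wbad g s)); last first.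
  move=> u /mapP[i]; rewrite mem_iota => hi ->.
  by case: i hi => [|[|i]] // hi; apply: wbad_insSS; lia.
by rewrite size_map size_iota; ring.
Qed.

End InsertionSums.

Definition Sgood n g := sumR (wgood g) (perms n).
Definition Sbad n g := sumR (wbad g) (perms n).

Lemma perms_cons n s : s \in perms n.+1 ->
  exists x t, [/\ s = x :: t, (0 < x)%N, all (leq 1) t & size t = n].
Proof.
rewrite mem_perms => /andP[/is_perm_pos]; case: s => //= x t /andP[x0 t0] /eqP[st].
by exists x, t.
Qed.

Lemma Sgood1 g : Sgood 1 g = 0.
Proof. by rewrite /Sgood /= /wgood /=; ring. Qed.

Lemma Sbad1 g : Sbad 1 g = g 1%N.
Proof. by rewrite /Sbad /= /wbad /=; ring. Qed.

Lemma SgoodS n g : Sgood n.+2 g = Sbad n.+1 g + INR n.+1 * Sgood n.+1 g.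
Proof.
rewrite {1}/Sgood -[perms n.+2]/([seq ins i s | s <- perms n.+1, i <- iota 0 n.+2]).
rewrite sumR_allpairs -sumR_scal -sumR_add; apply: sumR_eq => s.
case/perms_cons=> x [t [-> x0 t0 <-]].
exact: wgood_ins_sum.
Qed.

Lemma SbadS n g :
  Sbad n.+2 g = INR n * Sbad n.+1 g + Sgood n.+1 (fun k => g k.+1).
Proof.
rewrite {1}/Sbad -[perms n.+2]/([seq ins i s | s <- perms n.+1, i <- iota 0 n.+2]).
rewrite sumR_allpairs -sumR_scal -sumR_add; apply: sumR_eq => s.
case/perms_cons=> x [t [-> x0 t0 <-]].
exact: wbad_ins_sum.
Qed.

(** The length is a successor because the empty permutation is good but in no basis. *)
Lemma sumR_basis (L : nat -> seq (seq nat)) n g :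
  (forall n, uniq (L n) /\
        forall s, s \in L n <-> (size s = n /\ exists p, basis p s)) ->
  sumR (fun s => g (lrmax s)) (L n.+1) = Sgood n.+1 g.
Proof.
move=> HL; have [uL mL] := HL n.+1.
rewrite /Sgood /wgood -(sumR_filter (fun s => g (nrec 0 s))).
rewrite -(@sumR_perm _ (L n.+1)).
  apply: sumR_eq => s /mL[_ /basisP[/is_perm_pos ps _ _]].
  by rewrite lrmaxE.
apply: uniq_perm => //; first by rewrite filter_uniq ?perms_uniq.
move=> s; rewrite mem_filter mem_perms; apply/idP/idP.
  by move/mL=> [-> /basisP[-> _ ->]]; rewrite eqxx.
move=> /and3P[gs ps /eqP sz]; apply/mL; split=> //; apply/basisP.
by rewrite sz.
Qed.

(** * Roots of the record polynomial *)

(* Values at u of the record polynomials of the permutations of length n+1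
   weighted by [wbad] and [wgood]. *)
Fixpoint bad_good (n : nat) (u : R) : R * R :=
  if n is m.+1 then
    let bg := bad_good m u in
    (INR m * bg.1 + u * bg.2, bg.1 + INR m.+1 * bg.2)
  else (u, 0).

Lemma bad_goodS n u : bad_good n.+1 u =
  (INR n * (bad_good n u).1 + u * (bad_good n u).2,
   (bad_good n u).1 + INR n.+1 * (bad_good n u).2).
Proof. by []. Qed.

(* Real and imaginary parts of the product of the 2j+1+it over j < n. *)
Fixpoint odd_prod (n : nat) (t : R) : R * R :=
  if n is m.+1 then
    let ab := odd_prod m t in
    ((2 * INR m + 1) * ab.1 - t * ab.2, (2 * INR m + 1) * ab.2 + t * ab.1)
  else (1, 0).

Lemma odd_prodS n t : odd_prod n.+1 t =
  ((2 * INR n + 1) * (odd_prod n t).1 - t * (odd_prod n t).2,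
   (2 * INR n + 1) * (odd_prod n t).2 + t * (odd_prod n t).1).
Proof. by []. Qed.

(* For this u the discriminant 1 + 4u of the recurrence is (it)^2. *)
Lemma bad_good_odd_prod n t : let u := - (1 + t * t) / 4 in
  2 ^ n.+1 * t * (bad_good n u).1 = 2 * u * (t * (odd_prod n t).1 - (odd_prod n t).2) /\
  2 ^ n.+1 * t * (bad_good n u).2 = 4 * u * (odd_prod n t).2.
Proof.
move=> u; elim: n => [|n]; first by rewrite /=; split; ring.
rewrite bad_goodS odd_prodS.
case: (bad_good n u) => b g; case: (odd_prod n t) => x y.
cbn [fst snd] => -[e1 e2].
rewrite -[2 ^ n.+2]/(2 * 2 ^ n.+1) S_INR; split.
  have -> : 2 * 2 ^ n.+1 * t * (INR n * b + u * g) =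
    2 * INR n * (2 ^ n.+1 * t * b) + 2 * u * (2 ^ n.+1 * t * g) by ring.
  by rewrite e1 e2 /u; field.
have -> : 2 * 2 ^ n.+1 * t * (b + (INR n + 1) * g) =
    2 * (2 ^ n.+1 * t * b) + 2 * (INR n + 1) * (2 ^ n.+1 * t * g) by ring.
by rewrite e1 e2 /u; field.
Qed.

Fixpoint odd_angle (n : nat) (t : R) : R :=
  if n is m.+1 then odd_angle m t + atan (t / (2 * INR m + 1)) else 0.

(** A factor w + it has argument [atan (t / w)], and arguments add. The modulus stays anonymous: a
    zero sine is enough to produce a root. *)
Lemma odd_prod_polar n t : exists r,
  (odd_prod n t).1 = r * cos (odd_angle n t) /\ (odd_prod n t).2 = r * sin (odd_angle n t).
Proof.
elim: n => [|n]; first by exists 1; rewrite /= cos_0 sin_0; split; ring.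
rewrite odd_prodS -[odd_angle n.+1 t]/(odd_angle n t + atan (t / (2 * INR n + 1))); case: (odd_prod n t) => a b /= [r [-> ->]].
set w := 2 * INR n + 1; set al := atan (t / w).
have w0 : 0 < w by rewrite /w; have := pos_INR n; lra.
have [al1 al2] := atan_bound (t / w).
have ca : 0 < cos al by apply: cos_gt_0; rewrite /al; lra.
have et : t = w * (sin al / cos al).
  by rewrite -[sin al / cos al]/(tan al) tan_atan; field; lra.
exists (r * w / cos al); rewrite cos_plus sin_plus; set th := odd_angle n t.
by split; rewrite {1}et -?/w; field; lra.
Qed.

Lemma bad_good_root n t k : 0 < t -> odd_angle n t = INR k * PI ->
  (bad_good n (- (1 + t * t) / 4)).2 = 0.
Proof.
move=> t0 e; have [_] := bad_good_odd_prod n t.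
have [r [_ ->]] := odd_prod_polar n t; rewrite e.
have -> : sin (INR k * PI) = 0.
  by apply: sin_eq_0_1; exists (Z.of_nat k); rewrite INR_IZR_INZ.
have p0 : 0 < 2 ^ n.+1 by apply: pow_lt; lra.
have : 0 < 2 ^ n.+1 * t by apply: Rmult_lt_0_compat.
nra.
Qed.

Lemma odd_angle_continuous n : continuity (odd_angle n).
Proof.
elim: n => [|n IH]; first exact: continuity_const.
apply: (continuity_plus _ (fun t => atan (t / (2 * INR n + 1)))) => //.
apply: (continuity_comp (fun t => t / (2 * INR n + 1))); last by apply: derivable_continuous => x; apply: derivable_pt_atan.
apply: continuity_mult; first exact: derivable_continuous derivable_id.
exact: continuity_const.
Qed.

Lemma odd_angle0 n : odd_angle n 0 = 0.
Proof.
by elim: n => //= n ->; rewrite /Rdiv Rmult_0_l atan_0; ring.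
Qed.

(** The denominators 2j + 1 with j < n are below 2N, so at t = 2N tan y each of the n angles is at
    least y. *)
Lemma odd_angle_ge n N y : 0 < y < PI / 2 -> (n <= N)%N ->
  INR n * y <= odd_angle n (2 * INR N * tan y).
Proof.
move=> [y0 y1]; have ty : 0 < tan y by apply: tan_gt_0.
elim: n => [|n IH] nN; first by rewrite /=; lra.
rewrite -[odd_angle _ _]/(odd_angle n _ + atan (_ / (2 * INR n + 1))) S_INR; have := IH (ltnW nN).
have lN : INR n + 1 <= INR N by rewrite -S_INR; apply: le_INR; apply/leP.
have n0 := pos_INR n.
suff : y <= atan (2 * INR N * tan y / (2 * INR n + 1)) by lra.
rewrite -{1}(atan_tan y); last by split; lra.
have h : tan y <= 2 * INR N * tan y / (2 * INR n + 1).
  apply: (Rmult_le_reg_r (2 * INR n + 1)); first lra.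
  rewrite /Rdiv Rmult_assoc Rinv_l; last lra.
  by nra.
case: (Rle_lt_or_eq_dec _ _ h) => [h'|<-]; last exact: Rle_refl.
by apply: Rlt_le; apply: atan_increasing.
Qed.

Lemma odd_angle_attains n k : (0 < k)%N -> (k.*2 < n)%N ->
  exists t, 0 < t /\ odd_angle n t = INR k * PI.
Proof.
move=> k0 kn; have pi0 := PI_RGT_0.
have k0' : 0 < INR k by apply: lt_0_INR; apply/ltP.
have kn' : 2 * INR k < INR n.
  by rewrite -[2]/(INR 2) -mult_INR; apply: lt_INR; apply/ltP; rewrite multE mul2n.
(* For this [y] the lower bound n y is exactly k pi, and 2k < n puts [y] below pi/2. The
   intermediate value theorem then starts from the angle 0 at t = 0. *)
pose y := INR k * PI / INR n.
have ey : INR n * y = INR k * PI by rewrite /y; field; lra.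
have y0 : 0 < y < PI / 2 by split; nra.
have ty : 0 < tan y by apply: tan_gt_0; case: y0.
have ge := @odd_angle_ge n n y y0 (leqnn n).
pose f t := odd_angle n t - INR k * PI.
have cf : continuity f.
  apply: continuity_minus; [exact: odd_angle_continuous | exact: continuity_const].
have [||t [[t0 _] ft]] := @IVT_cor f 0 (2 * INR n * tan y) cf.
- by nra.
- rewrite /f odd_angle0; have : 0 < INR k * PI by nra.
  by nra.
exists t; split; last by rewrite /f in ft; lra.
case: t0 => // e; move: ft; rewrite -e /f odd_angle0; nra.
Qed.

(** Different k give different angles, hence different t > 0, on which u is injective. *)
Lemma bad_good_distinct_roots n K : (K.*2 < n)%N -> exists rs : seq R,
  [/\ size rs = K, List.NoDup rs & forall u, List.In u rs ->
   exists t k, [/\ 0 < t, (k <= K)%N, odd_angle n t = INR k * PI & u = - (1 + t * t) / 4]].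
Proof.
elim: K => [|K IH] hK; first by exists [::]; split=> //; constructor.
have [|rs [sz nd hrs]] := IH; first by lia.
have [t [t0 et]] := @odd_angle_attains n K.+1 isT hK.
exists (- (1 + t * t) / 4 :: rs); split=> /=; first by rewrite sz.
  constructor=> // /hrs[t' [k [t0' hk et' e]]].
  have ett : t = t' by nra.
  have := PI_RGT_0; have : INR k <= INR K by apply: le_INR; apply/leP.
  move: et'; rewrite -ett et S_INR; nra.
move=> u [<-|/hrs[t' [k [t0' hk et' e]]]].
  by exists t, K.+1.
by exists t', k; split=> //; lia.
Qed.

(** * Sums of independent Bernoulli variables *)

Fixpoint bern_mean (ps : seq R) (g : nat -> R) : R :=
  if ps is p :: ps' then (1 - p) * bern_mean ps' g + p * bern_mean ps' (fun k => g k.+1)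
  else g 0%N.

(** * Record polynomials and their factorisation into Bernoulli factors *)

Section PolynomialWeights.
Import GRing.Theory.
Local Open Scope ring_scope.

Fixpoint bad_good_poly (n : nat) : {poly R} * {poly R} :=
  if n is m.+1 then
    let bg := bad_good_poly m in
    (m%:R *: bg.1 + 'X * bg.2, bg.1 + m.+1%:R *: bg.2)
  else ('X, 0).

(** The linear form sending X^k to [g k]. Multiplication by X shifts [g], so a factorisation of the
    polynomial becomes a statement about all weights at once. *)
Definition weigh (p : {poly R}) (g : nat -> R) : R := \sum_(k < size p) p`_k * g k.

Lemma weigh_widen (p : {poly R}) g N : (size p <= N)%N ->
  weigh p g = \sum_(k < N) p`_k * g k.
Proof.
move=> h; rewrite /weigh (big_ord_widen N (fun k => p`_k * g k)) // big_mkcond /=.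
apply: eq_bigr => i _; case: ltnP => // hi.
by rewrite nth_default // mul0r.
Qed.

Lemma weigh_add p q g : weigh (p + q) g = weigh p g + weigh q g.
Proof.
set N := maxn (size p) (size q).
rewrite (@weigh_widen p g N) ?leq_maxl // (@weigh_widen q g N) ?leq_maxr //.
rewrite (@weigh_widen (p + q) g N) ?size_polyD // -big_split /=.
by apply: eq_bigr => i _; rewrite coefD mulrDl.
Qed.

Lemma weigh_scale c p g : weigh (c *: p) g = c * weigh p g.
Proof.
rewrite (@weigh_widen _ g (size p)) ?size_scale_leq // mulr_sumr.
by apply: eq_bigr => i _; rewrite coefZ mulrA.
Qed.

Lemma weigh_mulX p g : weigh ('X * p) g = weigh p (fun k => g k.+1).
Proof.
rewrite (@weigh_widen _ g (size p).+1) ?size_mulXl_leq //; last first.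
  by apply: leq_trans (size_polyMleq _ _) _; rewrite size_polyX addSn add1n.
rewrite big_ord_recl coefXM /= mul0r add0r.
by apply: eq_bigr => i _; rewrite coefXM.
Qed.

Lemma weigh_const c g : weigh c%:P g = c * g 0%N.
Proof.
by rewrite (@weigh_widen _ g 1) ?size_polyC_leq1 // big_ord1 coefC.
Qed.

Lemma Sgood_weigh n g :
  Sbad n.+1 g = weigh (bad_good_poly n).1 g /\ Sgood n.+1 g = weigh (bad_good_poly n).2 g.
Proof.
elim: n g => [|n IH] g /=.
  rewrite Sbad1 Sgood1 -['X]mulr1 weigh_mulX weigh_const mul1r.
  by rewrite -[0]/(0%:P) weigh_const mul0r.
have [hb hg] := IH g; have [_ hg'] := IH (fun k => g k.+1).
rewrite SbadS SgoodS !weigh_add !weigh_scale weigh_mulX -hb -hg -hg'.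
by rewrite -!INRE; split.
Qed.

Lemma horner_bad_good n u :
  (bad_good_poly n).1.[u] = (bad_good n u).1 /\ (bad_good_poly n).2.[u] = (bad_good n u).2.
Proof.
elim: n => [|n [e1 e2]]; first by rewrite /= hornerX horner0.
by rewrite bad_goodS /= !hornerE e1 e2 -!INRE.
Qed.

(** The factor X occurs only in passing from the second component to the first, and the way back
    takes another step, so degrees grow every second step. *)
Lemma size_bad_good n : (size (bad_good_poly n).1 <= n./2.+2)%N /\
  (size (bad_good_poly n).2 <= (n.+1)./2.+1)%N.
Proof.
elim: n => [|n [h1 h2]]; first by rewrite /= size_polyX size_poly0.
rewrite [bad_good_poly _]/=; cbn [fst snd]; split; apply: leq_trans (size_polyD _ _) _; rewrite geq_max.
  apply/andP; split; first by apply: leq_trans (size_scale_leq _ _) _; lia.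
  by apply: leq_trans (size_polyMleq _ _) _; rewrite size_polyX; lia.
apply/andP; split; first by lia.
by apply: leq_trans (size_scale_leq _ _) _; lia.
Qed.

Definition bern_poly (ps : seq R) : {poly R} := \prod_(p <- ps) (p *: 'X + (1 - p)%:P).

Lemma weigh_bern ps g : weigh (bern_poly ps) g = bern_mean ps g.
Proof.
elim: ps g => [|p ps IH] g; rewrite /bern_poly ?big_nil ?big_cons.
  by rewrite -[1]/(1%:P) weigh_const mul1r.
rewrite -/(bern_poly ps) mulrDl weigh_add -scalerAl weigh_scale weigh_mulX mul_polyC.
by rewrite weigh_scale !IH /= addrC.
Qed.

(** X - r equals 1 - r times p X + (1 - p) for p = 1/(1 - r), a probability when r <= 0. *)
Lemma prod_root_bern (rs : seq R) : (forall r, r \in rs -> r != 1) ->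
  exists c, \prod_(r <- rs) ('X - r%:P) = c *: bern_poly [seq (1 - r)^-1 | r <- rs].
Proof.
elim: rs => [|r rs IH] h; first by exists 1; rewrite /bern_poly !big_nil scale1r.
have [|c e] := IH; first by move=> x hx; apply: h; rewrite inE hx orbT.
exists (c * (1 - r)); rewrite big_cons e /bern_poly /= big_cons -scalerAr -scalerA; congr (_ *: _).
rewrite scalerAl; congr (_ * _); rewrite scalerDr scalerA.
have nz : 1 - r != 0 by rewrite subr_eq0 eq_sym h ?mem_head.
rewrite mulfV // scale1r -mul_polyC -polyCM mulrBr mulr1 mulfV //.
by rewrite addrAC subrr add0r polyCN.
Qed.

Lemma poly_distinct_roots_bern (P : {poly R}) (rs : seq R) :
  (size P <= (size rs).+1)%N -> P != 0 -> uniq rs -> all (root P) rs ->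
  (forall r, r \in rs -> r != 1) ->
  exists c, P = c *: bern_poly [seq (1 - r)^-1 | r <- rs].
Proof.
move=> sP P0 us rP r1; have := max_poly_roots P0 rP us => lt.
have sz : size P = (size rs).+1 by apply/eqP; rewrite eqn_leq sP.
rewrite (all_roots_prod_XsubC sz rP); last by rewrite uniq_rootsE.
have [c ->] := prod_root_bern r1.
by exists (lead_coef P * c); rewrite scalerA.
Qed.

(** The root 0 has parameter 1: a sure success, visible as the shift of [g]. *)
Lemma bern_mean_factor (P : {poly R}) (rs : seq R) :
  (size P <= (size rs).+2)%N -> P != 0 -> P.[0] = 0 -> uniq rs -> all (root P) rs ->
  (forall r, r \in rs -> r != 0) -> (forall r, r \in rs -> r != 1) ->
  exists c, forall g,
    weigh P g = c * bern_mean [seq (1 - r)^-1 | r <- rs] (fun k => g k.+1).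
Proof.
move=> sP P0 P00 us rP r0 r1.
have [|||c e] := @poly_distinct_roots_bern P (0 :: rs) sP P0 _ _ _.
- by rewrite /= us andbT; apply/negP => /r0; rewrite eqxx.
- by rewrite /= rP /root P00 eqxx.
- by move=> r; rewrite inE => /orP[/eqP-> | /r1 //]; rewrite eq_sym oner_neq0.
exists c => g; rewrite e weigh_scale weigh_bern /= subr0 invr1 RplusE !RmultE.
by rewrite RminusE R1E subrr mul0r add0r mul1r.
Qed.

End PolynomialWeights.

Lemma Sgood_pos n : (0 < n)%N -> 0 < (Sgood n.+1 (fun _ => 1)).
Proof.
have aux m : 0 <= (Sbad m.+1 (fun _ => 1)) /\ 0 <= (Sgood m.+1 (fun _ => 1)) /\
    ((0 < m)%N -> 0 < Sgood m.+1 (fun _ => 1)).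
  elim: m => [|m [hb [hg hg']]].
    by rewrite Sbad1 Sgood1; split; [lra | split; [lra | ]].
  rewrite SbadS SgoodS; have m0 := pos_INR m.
  have e : INR m.+1 = INR m + 1 by rewrite S_INR.
  case: m => [|m] in hb hg hg' m0 e *.
    rewrite Sbad1 Sgood1; split; [|split]; first by rewrite /=; lra.
    - by rewrite /=; lra.
    by move=> _; rewrite /=; lra.
  have := hg' isT; rewrite e; split; [|split]; nra.
by move=> n0; have [_ [_]] := aux n; apply.
Qed.

Lemma bern_mean1 ps : bern_mean ps (fun _ => 1) = 1.
Proof. by elim: ps => //= p ps ->; ring. Qed.

Lemma good_bernoulli n : (0 < n)%N -> exists ps : seq R,
  (forall p, List.In p ps -> 0 <= p <= 4 / 5) /\
  forall g, Sgood n.+1 g = Sgood n.+1 (fun _ => 1) * bern_mean ps (fun k => g k.+1).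
Proof.
(* The largest [K] with 2K < n. Adding the root 0 gives (n + 1)/2 rounded down, which is the degree
   bound. *)
move=> n0; pose K := (n.-1)./2.
have [|us [sz nd hus]] := @bad_good_distinct_roots n K; first by rewrite /K; lia.
have inP (u : R) (s : seq R) : u \in s -> List.In u s.
  by elim: s => //= y s IH; rewrite inE => /orP[/eqP ->|/IH]; [left|right].
have hneg u : u \in us -> u <= - (1 / 4).
  by move=> /inP/hus[t [k [t0 _ _ ->]]]; nra.
set P := (bad_good_poly n).2.
have szP : (size P <= (size us).+2)%N.
  by rewrite sz /K; apply: leq_trans (size_bad_good n).2 _; lia.
have spos := Sgood_pos n0.
have P0 : P != 0%R.
  apply/eqP => e; move: spos; rewrite (Sgood_weigh _ _).2 -/P e.
  by rewrite /weigh size_poly0 big_ord0 => /Rlt_irrefl.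
have P00 : P.[0]%R = 0%R.
  rewrite /P (horner_bad_good _ _).2; have : (bad_good n 0).1 = 0 /\ (bad_good n 0).2 = 0.
    elim: (n) => // m [e1 e2]; rewrite bad_goodS e1 e2 /=; split; ring.
  by case.
have uus : uniq us.
  elim: (us) nd => //= y s IH /List.NoDup_cons_iff[hy hs]; rewrite IH // andbT.
  by apply/negP => /inP.
have rus : all (root P) us.
  apply/allP => u /inP/hus[t [k [t0 _ et ->]]].
  by rewrite /root (horner_bad_good _ _).2 (bad_good_root t0 et).
have [||c hc] := bern_mean_factor szP P0 P00 uus rus.
- by move=> r /hneg h; apply/eqP => e; move: h; rewrite e; rewrite -R0E; lra.
- by move=> r /hneg h; apply/eqP => e; move: h; rewrite e; rewrite -R1E; lra.
exists [seq / (1 - r) | r <- us]; split.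
  move=> p /List.in_map_iff[r [<- hr]]; have [t [k [t0 _ _ e]]] := hus _ hr.
  have hr' : 5 / 4 <= 1 - r by nra.
  split; first by apply: Rlt_le; apply: Rinv_0_lt_compat; lra.
  apply: (Rmult_le_reg_r (1 - r)); first lra.
  by rewrite Rinv_l; lra.
have hc' g : Sgood n.+1 g = c * bern_mean [seq / (1 - r) | r <- us] (fun k => g k.+1).
  by rewrite (Sgood_weigh _ _).2 hc.
(* The constant weight 1 identifies [c] as the total count. *)
by move=> g; rewrite !hc' bern_mean1; ring.
Qed.

(** * Mean *)

Notation s5 := (sqrt 5).

Lemma s5_sqr : s5 * s5 = 5.
Proof. by apply: sqrt_sqrt; lra. Qed.

Lemma s5_bounds : 11 / 5 < s5 < 23 / 10.
Proof. have := s5_sqr; have := sqrt_pos 5; split; nra. Qed.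

(* Eigenvalues of the recurrence at u = 1; (1, 1 + l) is the left eigenvector for l. *)
Definition lamp := (s5 - 1) / 2.
Definition lamm := (- s5 - 1) / 2.

Section EigenCoordinates.
Variable l : R.
Hypothesis hl : l * l + l = 1.

Definition eigc (n : nat) (g : nat -> R) : R := Sbad n.+1 g + (1 + l) * Sgood n.+1 g.

Lemma eigc1S n :
  eigc n.+1 (fun _ => 1) = (INR n.+1 + l) * eigc n (fun _ => 1).
Proof.
have hl2 : l * l = 1 - l by lra.
by rewrite /eigc SbadS SgoodS S_INR; ring [hl2].
Qed.

Lemma Sgood_INR_S n : Sgood n (fun k => INR k.+1) = Sgood n INR + Sgood n (fun _ => 1).
Proof.
rewrite /Sgood -sumR_add; apply: sumR_eq => s _; rewrite /wgood S_INR.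
by case: ifP => _; ring.
Qed.

(** Shifting the weight [INR] adds the weight 1, so this coordinate is driven by the total count. *)
Lemma eigcIS n :
  eigc n.+1 INR = (INR n.+1 + l) * eigc n INR + Sgood n.+1 (fun _ => 1).
Proof.
have hl2 : l * l = 1 - l by lra.
by rewrite /eigc SbadS SgoodS Sgood_INR_S S_INR; ring [hl2].
Qed.

Lemma eigc1_0 : eigc 0 (fun _ => 1) = 1.
Proof. by rewrite /eigc Sbad1 Sgood1; ring. Qed.

Lemma eigcI_0 : eigc 0 INR = 1.
Proof. by rewrite /eigc Sbad1 Sgood1 /=; ring. Qed.

End EigenCoordinates.

Lemma lampE : lamp * lamp + lamp = 1.
Proof. rewrite /lamp; have := s5_sqr; nra. Qed.

Lemma lammE : lamm * lamm + lamm = 1.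
Proof. rewrite /lamm; have := s5_sqr; nra. Qed.

Lemma Sgood_eigc n g : Sgood n.+1 g = (eigc lamp n g - eigc lamm n g) / s5.
Proof. by have := s5_bounds; rewrite /eigc /lamp /lamm => h; field; lra. Qed.

Definition yp n := eigc lamp n (fun _ => 1).
(** Everything is measured against the dominant coordinate [yp]: [eps] vanishes, [Rn] grows
    logarithmically, [Qn] stays bounded, and the mean is (Rn - Qn) / (1 - eps). *)
Definition eps n := eigc lamm n (fun _ => 1) / yp n.
(* The weight [INR] is the derivative at u = 1 of the weight [u ^ k]. *)
Definition Rn n := eigc lamp n INR / yp n.
Definition Qn n := eigc lamm n INR / yp n.

Lemma yp_pos n : 0 < yp n.
Proof.
elim: n => [|n IH]; first by rewrite /yp eigc1_0; lra.
rewrite /yp (eigc1S lampE) S_INR; have := pos_INR n; have := s5_bounds.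
by rewrite /lamp => h1 h2; apply: Rmult_lt_0_compat => //; lra.
Qed.

Lemma ypS n : yp n.+1 = (INR n.+1 + lamp) * yp n.
Proof. exact: eigc1S lampE _. Qed.

Lemma den_pos n : 0 < INR n.+1 + lamp.
Proof. by rewrite S_INR /lamp; have := pos_INR n; have := s5_bounds; lra. Qed.

Lemma epsS n : eps n.+1 = eps n * (INR n.+1 + lamm) / (INR n.+1 + lamp).
Proof.
rewrite /eps ypS (eigc1S lammE); have := yp_pos n; have := den_pos n.
by move=> h1 h2; field; lra.
Qed.

(** The factor 1/s5 of the limit enters here, through the recovery of [Sgood] as a difference of
    eigencoordinates; what remains is nearly a harmonic sum. *)
Lemma RnS n : Rn n.+1 = Rn n + (1 - eps n) / (s5 * (INR n.+1 + lamp)).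
Proof.
rewrite /Rn /eps ypS (eigcIS lampE) Sgood_eigc -/(yp n).
have := yp_pos n; have := den_pos n; have := s5_bounds.
by move=> h1 h2 h3; field; lra.
Qed.

Lemma QnS n :
  Qn n.+1 = ((INR n.+1 + lamm) * Qn n + (1 - eps n) / s5) / (INR n.+1 + lamp).
Proof.
rewrite /Qn /eps ypS (eigcIS lammE) Sgood_eigc -/(yp n).
have := yp_pos n; have := den_pos n; have := s5_bounds.
by move=> h1 h2 h3; field; lra.
Qed.

(** The true decay is of order n^(-s5). As s5 > 1, the weaker rate 1/n passes through the induction,
    and it is summable against 1/n. *)
Lemma eps_bound n : - 1 <= INR n.+1 * eps n <= 1.
Proof.
elim: n => [|n IH]; first by rewrite /eps /yp !eigc1_0 /=; lra.
rewrite epsS; have d := den_pos n; have h5 := s5_bounds.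
rewrite (S_INR n.+1); set m := INR n.+1 in IH d *.
(* The factor [m + lamm] is negative for m = 1 only. *)
have m1 : m = 1 \/ 2 <= m.
  case: n @m {IH d} => [|n]; [by left | right].
  by rewrite !S_INR; have := pos_INR n; lra.
have -> : (m + 1) * (eps n * (m + lamm) / (m + lamp)) =
  (m * eps n) * ((m + 1) * (m + lamm) / (m * (m + lamp))).
  by field; lra.
set q := (m + 1) * (m + lamm) / (m * (m + lamp)).
have d2 : 0 < m * (m + lamp) by apply: Rmult_lt_0_compat => //; lra.
have eq : q * (m * (m + lamp)) = (m + 1) * (m + lamm) by rewrite /q; field; lra.
have : -1 <= q <= 1.
  by case: m1 => h; split; apply: (Rmult_le_reg_r (m * (m + lamp))) => //; rewrite eq ?h /lamp /lamm; nra.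
move=> [q1 q2]; split; nra.
Qed.

Lemma eps_abs n : Rabs (eps n) <= / INR n.+1.
Proof.
have m0 : 0 < INR n.+1 by apply: lt_0_INR; apply/ltP.
have [h1 h2] := eps_bound n.
apply: (Rmult_le_reg_l (INR n.+1)) => //; rewrite Rinv_r; last lra.
rewrite -{1}(Rabs_pos_eq (INR n.+1)); last lra.
by rewrite -Rabs_mult; apply: Rabs_le.
Qed.

Lemma eps_le1 n : - 1 <= eps n <= 1.
Proof.
have [h1 h2] := eps_bound n; have : 1 <= INR n.+1 by rewrite S_INR; have := pos_INR n; lra.
by move=> h; split; nra.
Qed.

Lemma Qn_bound n : - 1 <= Qn n <= 1.
Proof.
elim: n => [|n IH]; first by rewrite /Qn /yp !eigc1_0 !eigcI_0 /=; lra.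
rewrite QnS; have d := den_pos n; have h5 := s5_bounds; have e := eps_le1 n.
set y := (1 - eps n) / s5.
have ys : y * s5 = 1 - eps n by rewrite /y; field; lra.
have hy : 0 <= y <= 1 by split; nra.
(* At the first step the coefficient of [Qn] is negative, but there [eps] is 1 and the forcing term
   vanishes. *)
have m1 : INR n.+1 = 1 /\ y = 0 \/ 2 <= INR n.+1.
  rewrite /y; case: (n) => [|k]; [left | right].
    by rewrite /eps /yp !eigc1_0 /=; split=> //; field; lra.
  by rewrite !S_INR; have := pos_INR k; lra.
have hm : - (INR n.+1 + lamp) <= (INR n.+1 + lamm) * Qn n + y <= INR n.+1 + lamp.
  by case: m1 => [[-> ->]|h]; rewrite /lamm /lamp; split; nra.
split; apply: (Rmult_le_reg_r (INR n.+1 + lamp)) => //.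
  by rewrite /Rdiv Rmult_assoc Rinv_l; lra.
by rewrite /Rdiv Rmult_assoc Rinv_l; lra.
Qed.

Lemma ln_quot x y : 0 < x -> 0 < y -> ln (x / y) = ln x - ln y.
Proof.
by move=> x0 y0; rewrite /Rdiv ln_mult ?ln_Rinv //; apply: Rinv_0_lt_compat.
Qed.

Lemma ln_succ_bounds x : 0 < x -> / (x + 1) <= ln (x + 1) - ln x <= / x.
Proof.
move=> x0; have ix : 0 < / x by apply: Rinv_0_lt_compat.
have ln_le y : 0 < y -> ln y <= y - 1.
  by move=> y0; have := exp_ineq1_le (ln y); rewrite exp_ln //; lra.
split.
  have := ln_le (x / (x + 1)); rewrite ln_quot; try lra.
  move=> h; have : 0 < x / (x + 1) by apply: Rdiv_lt_0_compat; lra.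
  move/h; have -> : x / (x + 1) - 1 = - / (x + 1) by field; lra.
  lra.
have := ln_le ((x + 1) / x); rewrite ln_quot; try lra.
move=> h; have : 0 < (x + 1) / x by apply: Rdiv_lt_0_compat; lra.
by move/h; have -> : (x + 1) / x - 1 = / x by field; lra.
Qed.

(** The form 1 - 1/m telescopes. A step costs 1/m - 1/(m+1) once for the harmonic term against the
    logarithm and twice for [eps]; the constant 5 leaves room. *)
Lemma Rn_bound n :
  Rabs (Rn n - 1 - ln (INR n.+1) / s5) <= 5 * (1 - / INR n.+1).
Proof.
elim: n => [|n IH].
  rewrite /Rn /yp eigc1_0 eigcI_0 /= ln_1 Rinv_1.
  by have -> : 1 / 1 - 1 - 0 / s5 = 0; [have := s5_bounds => h; field; lra | rewrite Rabs_R0; lra].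
have m1 : 1 <= INR n.+1 by rewrite S_INR; have := pos_INR n; lra.
rewrite RnS (S_INR n.+1); have := eps_abs n; set m := INR n.+1 in IH m1 *.
set e := eps n => he; have h5 := s5_bounds.
have [l1 l2] : / (m + 1) <= ln (m + 1) - ln m <= / m by apply: ln_succ_bounds; lra.
have lp : 0 < lamp < 1 by rewrite /lamp; lra.
have i1 : / (m + 1) <= / (m + lamp) by apply: Rinv_le_contravar; lra.
have i2 : / (m + lamp) <= / m by apply: Rinv_le_contravar; lra.
have i0 : 0 < / (m + 1) by apply: Rinv_0_lt_compat; lra.
have im1 : / m <= 1 by rewrite -[X in _ <= X]Rinv_1; apply: Rinv_le_contravar; lra.
set d := (1 - e) * / (m + lamp) - (ln (m + 1) - ln m).
have -> : Rn n + (1 - e) / (s5 * (m + lamp)) - 1 - ln (m + 1) / s5 =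
  (Rn n - 1 - ln m / s5) + d / s5 by rewrite /d; field; lra.
have ediff : / m - / (m + 1) = / m * / (m + 1) by field; lra.
have hm2 : / m <= 2 * / (m + 1).
  by apply: (Rmult_le_reg_r (m * (m + 1))); first nra; field_simplify; lra.
have hd : Rabs d <= 3 * (/ m - / (m + 1)).
  have -> : d = (/ (m + lamp) - (ln (m + 1) - ln m)) + - (e * / (m + lamp)) by rewrite /d; ring.
  apply: Rle_trans (Rabs_triang _ _) _; rewrite Rabs_Ropp Rabs_mult.
  rewrite (Rabs_pos_eq (/ (m + lamp))); last lra.
  have : Rabs (/ (m + lamp) - (ln (m + 1) - ln m)) <= / m - / (m + 1) by apply: Rabs_le; lra.
  have := Rabs_pos e; nra.
apply: Rle_trans (Rabs_triang _ _) _.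
have : Rabs (d / s5) <= 5 * (/ m - / (m + 1)); last by lra.
have is5 : 0 < / s5 by apply: Rinv_0_lt_compat; lra.
rewrite /Rdiv Rabs_mult (Rabs_pos_eq (/ s5)); last lra.
apply: (Rmult_le_reg_r s5); first lra.
rewrite Rmult_assoc Rinv_l; last lra.
have := Rabs_pos d; nra.
Qed.

Definition mean_good n := Sgood n.+1 INR / Sgood n.+1 (fun _ => 1).

(** In units of 1/ln m: [D] is at most 5 + 2, so s5 times [D] costs at most 17, [eps] adds 1, and
    dividing by 1 - eps >= 1/2 at most doubles the sum. *)
Lemma mean_good_asymp n : (0 < n)%N ->
  Rabs (mean_good n / (ln (INR n.+1) / s5) - 1) <= 50 / ln (INR n.+1).
Proof.
move=> n0; set m := INR n.+1; have h5 := s5_bounds.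
have m2 : 2 <= m.
  by case: n n0 @m => // n _; rewrite !S_INR; have := pos_INR n; lra.
have lpos : 0 < ln m by rewrite -ln_1; apply: ln_increasing; lra.
have lm : ln m <= m by have := exp_ineq1_le (ln m); rewrite exp_ln; lra.
have eb : Rabs (eps n) <= / m by exact: eps_abs.
have im : / m <= / 2 by apply: Rinv_le_contravar; lra.
have iml : / m <= / ln m by apply: Rinv_le_contravar.
have il : 0 < / ln m by apply: Rinv_0_lt_compat.
have e1 : eps n <= / 2 by have := Rle_abs (eps n); lra.
have yn := yp_pos n.
have em : mean_good n = (Rn n - Qn n) / (1 - eps n).
  have ek : eigc lamm n (fun _ => 1) = eps n * yp n by rewrite /eps; field; lra.
  rewrite /mean_good !Sgood_eigc ek -/(yp n) /Rn /Qn.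
  have : yp n - eps n * yp n <> 0 by nra.
  by move=> hne; field; repeat split; nra.
set D := Rn n - Qn n - ln m / s5.
have hD : Rabs D <= 7.
  have -> : D = (Rn n - 1 - ln m / s5) + (1 - Qn n) by rewrite /D; ring.
  apply: Rle_trans (Rabs_triang _ _) _.
  have := Rn_bound n; rewrite -/m; have [q1 q2] := Qn_bound n.
  have : Rabs (1 - Qn n) <= 2 by apply: Rabs_le; lra.
  have : 0 < / m by apply: Rinv_0_lt_compat; lra.
  lra.
have -> : mean_good n / (ln m / s5) - 1 = (s5 * D / ln m + eps n) / (1 - eps n).
  by rewrite em /D; field; repeat split; lra.
have i1e : 0 < / (1 - eps n) by apply: Rinv_0_lt_compat; lra.
rewrite [Rabs (_ / (1 - _))]Rabs_mult (Rabs_pos_eq (/ (1 - eps n))); last lra.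
apply: (Rmult_le_reg_r (1 - eps n)); first lra.
rewrite Rmult_assoc Rinv_l; last lra.
rewrite Rmult_1_r; apply: Rle_trans (Rabs_triang _ _) _.
rewrite -[s5 * D / ln m]/(s5 * D * / ln m) (Rabs_mult _ (/ ln m)) (Rabs_mult s5).
rewrite (Rabs_pos_eq s5) ?(Rabs_pos_eq (/ ln m)); try lra.
have D17 : s5 * Rabs D <= 17 by have := Rabs_pos D; nra.
have : s5 * Rabs D * / ln m <= 17 * / ln m by apply: Rmult_le_compat_r; lra.
have : 25 * / ln m <= 50 * / ln m * (1 - eps n) by nra.
lra.
Qed.

(** * The Gaussian integral and Mills ratio *)

Definition phi (t : R) : R := exp (- (t * t) / 2).

Lemma phi_pos t : 0 < phi t.
Proof. exact: exp_pos. Qed.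

Lemma is_derive_phi t : is_derive phi t (- t * phi t).
Proof. by rewrite /phi; auto_derive => //; rewrite /Rdiv; ring_simplify; field. Qed.

Lemma phi_continuous t : continuous phi t.
Proof. by apply: ex_derive_continuous; exists (- t * phi t); apply: is_derive_phi. Qed.

Lemma phi_even t : phi (- t) = phi t.
Proof. by rewrite /phi; congr exp; field. Qed.

Lemma phi_le1 t : phi t <= 1.
Proof.
rewrite -exp_0 /phi; case: (Req_dec t 0) => [->|t0].
  by right; congr exp; field.
by left; apply: exp_increasing; nra.
Qed.

Lemma phi_small t : phi t * (t * t) <= 2.
Proof.
have h := exp_ineq1_le (t * t / 2).
have e : phi t * exp (t * t / 2) = 1.
  by rewrite /phi -exp_plus -exp_0; congr exp; field.
have := phi_pos t; nra.
Qed.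

Definition Ig (x : R) : R := RInt phi 0 x.

Lemma ex_RInt_phi a b : ex_RInt phi a b.
Proof. by apply: ex_RInt_continuous => z _; apply: phi_continuous. Qed.

Lemma is_derive_Ig x : is_derive Ig x (phi x).
Proof.
apply: (is_derive_RInt phi Ig 0 x); last exact: phi_continuous.
by apply: filter_forall => y; apply: RInt_correct; apply: ex_RInt_phi.
Qed.

Lemma Ig0 : Ig 0 = 0.
Proof. exact: RInt_point. Qed.

Lemma RInt_phi a b : RInt phi a b = Ig b - Ig a.
Proof.
have : Ig a + RInt phi a b = Ig b := RInt_Chasles phi 0 a b (ex_RInt_phi _ _) (ex_RInt_phi _ _).
lra.
Qed.

Lemma MVT_derive (f df : R -> R) a b :
  (forall x, is_derive f x (df x)) -> exists c, Rmin a b <= c <= Rmax a b /\ f b - f a = df c * (b - a).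
Proof.
move=> h; have [c [hc e]] := MVT_gen f a b df (fun x _ => h x)
  (fun x _ => ltac:(apply/continuity_pt_filterlim; apply: (@ex_derive_continuous R_AbsRing R_NormedModule); exists (df x); apply: h)).
by exists c.
Qed.

Lemma Ig_incr a b : a <= b -> Ig a <= Ig b.
Proof.
move=> ab; have [c [_ e]] := MVT_derive a b is_derive_Ig.
by have := phi_pos c; nra.
Qed.

Lemma Ig_lip a b : a <= b -> Ig b - Ig a <= b - a.
Proof.
move=> ab; have [c [_ e]] := MVT_derive a b is_derive_Ig.
by have := phi_le1 c; have := phi_pos c; nra.
Qed.

Lemma derive0_eq (f : R -> R) a b : (forall x, is_derive f x 0) -> f a = f b.
Proof.
by move=> h; have [c [_ e]] := @MVT_derive f (fun _ => 0) a b h; lra.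
Qed.

Lemma Ig_odd x : Ig (- x) = - Ig x.
Proof.
suff : Ig (- x) + Ig x = Ig (- 0) + Ig 0 by rewrite Ropp_0 Ig0; lra.
apply: (@derive0_eq (fun x => Ig (- x) + Ig x)) => y.
have -> : 0 = -1 * phi (- y) + phi y by rewrite phi_even; ring.
apply: (@is_derive_plus R_AbsRing R_NormedModule); last exact: is_derive_Ig.
apply: (@is_derive_comp R_AbsRing R_NormedModule Ig); first exact: is_derive_Ig.
by auto_derive.
Qed.

(* The classical auxiliary integral: Ig^2 + 2 Jg has derivative 0. *)
Definition Jint (x t : R) : R := exp (- (x * x) * (1 + t * t) / 2) / (1 + t * t).

Definition Jg (x : R) : R := RInt (Jint x) 0 1.

Lemma is_derive_Jint x t : is_derive (fun x => Jint x t) x (- x * exp (- (x * x) * (1 + t * t) / 2)).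
Proof. by rewrite /Jint; auto_derive; [nra | rewrite /Rdiv; field; nra]. Qed.

Lemma Jint_continuous x t : continuous (Jint x) t.
Proof.
apply: ex_derive_continuous; rewrite /Jint; auto_derive; nra.
Qed.

(** Differentiating under the integral cancels 1 + t^2, and substituting x t for the variable turns
    the rest into [Ig]. *)
Lemma is_derive_Jg x : is_derive Jg x (- phi x * Ig x).
Proof.
have -> : - phi x * Ig x = RInt (fun t => Derive (fun u => Jint u t) x) 0 1.
  have -> : RInt (fun t => Derive (fun u => Jint u t) x) 0 1 =
    RInt (fun t => scal (- phi x) (scal x (phi (x * t + 0)))) 0 1.
    apply: RInt_ext => t _; rewrite (is_derive_unique _ _ _ (is_derive_Jint x t)).
    rewrite /scal /= /mult /= /phi.
    have -> : - (x * x) * (1 + t * t) / 2 = - (x * x) / 2 + - ((x * t + 0) * (x * t + 0)) / 2 by field.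
    by rewrite exp_plus; ring.
  rewrite RInt_scal; last first.
    apply: ex_RInt_comp_lin; exact: ex_RInt_phi.
  rewrite RInt_comp_lin; last exact: ex_RInt_phi.
  by rewrite Rmult_0_r Rplus_0_r Rmult_1_r Rplus_0_r.
apply: is_derive_RInt_param.
- by apply: filter_forall => y t _; eexists; apply: is_derive_Jint.
- move=> t _.
  apply: (continuity_2d_pt_ext (fun u v => - u * exp (- (u * u) * (1 + v * v) / 2))).
    by move=> u v; rewrite (is_derive_unique _ _ _ (is_derive_Jint u v)).
  have id1 : continuity_2d_pt (fun u _ => u) x t by apply: continuity_2d_pt_id1.
  have id2 : continuity_2d_pt (fun _ v => v) x t by apply: continuity_2d_pt_id2.
  apply: continuity_2d_pt_mult; first exact: continuity_2d_pt_opp.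
  apply: (continuity_1d_2d_pt_comp exp (fun u v => - (u * u) * (1 + v * v) / 2)).
    by apply: derivable_continuous_pt; apply: derivable_pt_exp.
  apply: continuity_2d_pt_mult; last exact: continuity_2d_pt_const.
  apply: continuity_2d_pt_mult.
    by apply: continuity_2d_pt_opp; apply: continuity_2d_pt_mult.
  apply: continuity_2d_pt_plus; first exact: continuity_2d_pt_const.
  exact: continuity_2d_pt_mult.
apply: filter_forall => y; apply: ex_RInt_continuous => z _; exact: Jint_continuous.
Qed.

Lemma Jg0 : Jg 0 = PI / 4.
Proof.
rewrite /Jg (RInt_ext _ (fun t => / (1 + t * t))); last first.
  move=> t _; rewrite /Jint; have -> : - (0 * 0) * (1 + t * t) / 2 = 0 by field.
  by rewrite exp_0 /Rdiv Rmult_1_l.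
have h : is_RInt (fun t => / (1 + t * t)) 0 1 (minus (atan 1) (atan 0)).
  apply: (is_RInt_derive atan) => t _.
    exact: is_derive_atan.
  by apply: ex_derive_continuous; auto_derive; nra.
by rewrite (is_RInt_unique _ _ _ _ h) -[LHS]/(atan 1 - atan 0) atan_1 atan_0; ring.
Qed.

Lemma Ig_Jg x : Ig x * Ig x + 2 * Jg x = PI / 2.
Proof.
have -> : PI / 2 = Ig 0 * Ig 0 + 2 * Jg 0 by rewrite Ig0 Jg0; field.
apply: (@derive0_eq (fun x => Ig x * Ig x + 2 * Jg x)) => y.
have hI := is_derive_Ig y; have hJ := is_derive_Jg y.
auto_derive; first by repeat split; eexists; eassumption.
by rewrite (is_derive_unique _ _ _ hI) (is_derive_unique _ _ _ hJ); ring.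
Qed.

Lemma Jg_bounds x : 0 <= Jg x <= phi x.
Proof.
have ex : ex_RInt (Jint x) 0 1 by apply: ex_RInt_continuous => z _; exact: Jint_continuous.
have b t : 0 <= Jint x t <= phi x.
  have t2 : 1 <= 1 + t * t by nra.
  rewrite /Jint; split; first by apply: Rlt_le; apply: Rdiv_lt_0_compat; [exact: exp_pos | lra].
  have -> : - (x * x) * (1 + t * t) / 2 = - (x * x) / 2 + - ((x * t) * (x * t)) / 2 by field.
  rewrite exp_plus -/(phi x) -/(phi (x * t)).
  apply: (Rmult_le_reg_r (1 + t * t)); first lra.
  rewrite /Rdiv Rmult_assoc Rinv_l; last lra.
  have := phi_le1 (x * t); have := phi_pos (x * t); have := phi_pos x => h1 h2 h3.
  have : phi x * phi (x * t) <= phi x by nra.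
  nra.
split; first by apply: RInt_ge_0 => // [|t _]; [lra | case: (b t)].
have -> : phi x = RInt (fun _ => phi x) 0 1 by rewrite RInt_const /scal /= /mult /=; ring.
by apply: RInt_le => // [||t _]; [lra | apply: ex_RInt_const | case: (b t)].
Qed.

Definition kap : R := sqrt (2 * PI) / 2.

Lemma kap_sqr : kap * kap = PI / 2.
Proof.
have := PI_RGT_0 => h; have e : sqrt (2 * PI) * sqrt (2 * PI) = 2 * PI by apply: sqrt_sqrt; lra.
by rewrite /kap; lra.
Qed.

Lemma kap_ge1 : 1 <= kap.
Proof.
have := kap_sqr; have := PI2_1; have : 0 <= kap by rewrite /kap; have := sqrt_pos (2 * PI); lra.
nra.
Qed.

(** kap^2 - Ig^2 = 2 Jg <= 2 phi, and kap + Ig >= 1. This identifies [kap] as the half-line Gaussian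
    integral. *)
Lemma Ig_tail x : 0 <= x -> 0 <= kap - Ig x <= 2 * phi x.
Proof.
move=> x0; have := Ig_Jg x; have := Jg_bounds x; have := kap_sqr; have := kap_ge1.
have : 0 <= Ig x by rewrite -Ig0; apply: Ig_incr.
by move=> *; split; nra.
Qed.

Lemma nonneg_of_decr_to_0 (f df : R -> R) :
  (forall x, 0 < x -> is_derive f x (df x)) -> (forall x, 0 < x -> df x <= 0) ->
  (forall x, 1 <= x -> Rabs (f x) <= 3 * phi x) -> forall x, 1 <= x -> 0 <= f x.
Proof.
move=> hd hle hb x x1; apply: Rnot_lt_le => fx.
(* By monotonicity f y <= f x < 0, whereas at this point 3 phi(y) y <= 6 < -f(x) y. *)
pose y := x + 6 / - f x + 1.
have q0 : 0 < 6 / - f x by apply: Rdiv_lt_0_compat; lra.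
have y1 : x < y by rewrite /y; lra.
have y2 : 6 < - f x * y.
  have : - f x * (6 / - f x) = 6 by field; lra.
  rewrite /y; nra.
have [c [hc e]] : exists c, x <= c <= y /\ f y - f x = df c * (y - x).
  have := MVT_gen f x y df; rewrite Rmin_left ?Rmax_right; try lra.
  apply=> z hz; first by apply: hd; lra.
  apply/continuity_pt_filterlim; apply: (@ex_derive_continuous R_AbsRing R_NormedModule).
  by exists (df z); apply: hd; lra.
have : df c <= 0 by apply: hle; lra.
have := hb y ltac:(lra); have h2 := phi_small y; have h3 := phi_pos y.
have h4 := Rabs_maj2 (f y) => h5 h6.
have h7 : - f x <= 3 * phi y by nra.
have h8 : - f x * y <= 3 * phi y * y by apply: Rmult_le_compat_r; lra.
have : phi y * y * 1 <= phi y * y * y by apply: Rmult_le_compat_l; nra.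
lra.
Qed.

Definition mills (w : R) : R := (kap - Ig w) / phi w.

(** For both Mills bounds, a suitably scaled difference of the two sides decreases to 0. *)
Lemma mills_lower w : 1 <= w -> w <= (1 + w * w) * mills w.
Proof.
move=> w1.
have h : 0 <= kap - Ig w - w / (1 + w * w) * phi w.
  apply: (@nonneg_of_decr_to_0 (fun w => kap - Ig w - w / (1 + w * w) * phi w)
    (fun w => - (2 * phi w / ((1 + w * w) * (1 + w * w))))) w1 => {w} x x0.
  - have hI := is_derive_Ig x; have hp := is_derive_phi x.
    auto_derive; first by repeat split; try (eexists; eassumption); nra.
    by rewrite (is_derive_unique _ _ _ hI) (is_derive_unique _ _ _ hp); field; nra.
  - have : 0 < 2 * phi x / ((1 + x * x) * (1 + x * x)); last by lra.
    by apply: Rdiv_lt_0_compat; have := phi_pos x; nra.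
  have [t1 t2] := Ig_tail (Rle_trans _ _ _ Rle_0_1 x0); have p := phi_pos x.
  have q : 0 <= x / (1 + x * x) <= 1.
    split; first by apply: Rlt_le; apply: Rdiv_lt_0_compat; nra.
    by apply: (Rmult_le_reg_r (1 + x * x)); [nra | rewrite /Rdiv Rmult_assoc Rinv_l; nra].
  by apply: Rabs_le; nra.
have p := phi_pos w; rewrite /mills.
apply: (Rmult_le_reg_r (phi w / (1 + w * w))); first by apply: Rdiv_lt_0_compat; nra.
have -> : (1 + w * w) * ((kap - Ig w) / phi w) * (phi w / (1 + w * w)) = kap - Ig w by field; nra.
have -> : w * (phi w / (1 + w * w)) = w / (1 + w * w) * phi w by field; nra.
lra.
Qed.

Lemma mills_upper w : 1 <= w -> w * mills w <= 1.
Proof.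
move=> w1.
have h : 0 <= phi w / w - (kap - Ig w).
  apply: (@nonneg_of_decr_to_0 (fun w => phi w / w - (kap - Ig w))
    (fun w => - (phi w / (w * w)))) w1 => {w} x x0.
  - have hI := is_derive_Ig x; have hp := is_derive_phi x.
    auto_derive; first by repeat split; try (eexists; eassumption); lra.
    by rewrite (is_derive_unique _ _ _ hI) (is_derive_unique _ _ _ hp); field; lra.
  - have : 0 < phi x / (x * x); last by lra.
    by apply: Rdiv_lt_0_compat; have := phi_pos x; nra.
  have [t1 t2] := Ig_tail (Rle_trans _ _ _ Rle_0_1 x0); have p := phi_pos x.
  have q : 0 <= phi x / x <= phi x.
    split; first by apply: Rlt_le; apply: Rdiv_lt_0_compat; lra.
    by apply: (Rmult_le_reg_r x); [lra | rewrite /Rdiv Rmult_assoc Rinv_l; nra].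
  by apply: Rabs_le; nra.
have p := phi_pos w; rewrite /mills.
apply: (Rmult_le_reg_r (phi w / w)); first by apply: Rdiv_lt_0_compat; lra.
have -> : w * ((kap - Ig w) / phi w) * (phi w / w) = kap - Ig w by field; lra.
lra.
Qed.

(** * Stein's equation for a ramp *)

Definition Phi (x : R) : R := (Ig x + kap) / (2 * kap).

Lemma Phi_lip a b : a <= b -> Phi b - Phi a <= b - a.
Proof.
move=> ab; have := Ig_incr ab; have := Ig_lip ab; have := kap_ge1 => h1 h2 h3.
apply: (Rmult_le_reg_r (2 * kap)); first lra.
have -> : (Phi b - Phi a) * (2 * kap) = Ig b - Ig a by rewrite /Phi; field; lra.
nra.
Qed.

Definition ramp (a b t : R) : R := Rmax 0 (Rmin 1 ((b - t) / (b - a))).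

Section Ramp.
Variables a b : R.
Hypothesis ab : a < b.

Lemma ramp_bounds t : 0 <= ramp a b t <= 1.
Proof.
rewrite /ramp; split; first exact: Rmax_l.
by apply: Rmax_lub; [lra | apply: Rmin_l].
Qed.

Lemma ramp_left t : t <= a -> ramp a b t = 1.
Proof.
move=> ta; rewrite /ramp Rmin_left ?Rmax_right //; try lra.
by apply: (Rmult_le_reg_r (b - a)); [lra | rewrite /Rdiv Rmult_assoc Rinv_l; lra].
Qed.

Lemma ramp_right t : b <= t -> ramp a b t = 0.
Proof.
move=> bt; have h : (b - t) / (b - a) <= 0.
  by apply: (Rmult_le_reg_r (b - a)); [lra | rewrite /Rdiv Rmult_assoc Rinv_l; lra].
by rewrite /ramp Rmin_right ?Rmax_left //; lra.
Qed.

Lemma ramp_lip s t : Rabs (ramp a b s - ramp a b t) <= / (b - a) * Rabs (s - t).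
Proof.
have i0 : 0 < / (b - a) by apply: Rinv_0_lt_compat; lra.
have clip x y : Rabs (Rmax 0 (Rmin 1 x) - Rmax 0 (Rmin 1 y)) <= Rabs (x - y).
  rewrite /Rmax /Rmin; case: (Rle_dec 1 x) => ?; case: (Rle_dec 1 y) => ?;
    by repeat case: Rle_dec => ?; split_Rabs; lra.
apply: Rle_trans (clip _ _) _.
have -> : (b - s) / (b - a) - (b - t) / (b - a) = / (b - a) * - (s - t) by field; lra.
by rewrite Rabs_mult Rabs_Ropp (Rabs_pos_eq (/ (b - a))); lra.
Qed.

Lemma ramp_continuous t : continuous (ramp a b) t.
Proof.
have i0 : 0 < / (b - a) by apply: Rinv_0_lt_compat; lra.
apply/continuity_pt_filterlim => e e0; exists (e * (b - a)); split.
  by apply: Rmult_lt_0_compat => //; lra.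
move=> x [_]; rewrite /= /R_dist => hx; apply: Rle_lt_trans (ramp_lip _ _) _.
apply: (Rmult_lt_reg_r (b - a)); first lra.
have -> : / (b - a) * Rabs (x - t) * (b - a) = Rabs (x - t) by field; lra.
exact: hx.
Qed.

Definition Gr (w : R) : R := RInt (fun t => ramp a b t * phi t) 0 w.

Lemma ramp_phi_continuous t : continuous (fun t => ramp a b t * phi t) t.
Proof.
apply: (@continuous_mult R_UniformSpace R_AbsRing); [exact: ramp_continuous | exact: phi_continuous].
Qed.

Lemma ex_RInt_ramp_phi u v : ex_RInt (fun t => ramp a b t * phi t) u v.
Proof. by apply: ex_RInt_continuous => z _; apply: ramp_phi_continuous. Qed.

Lemma Gr_sub u v : RInt (fun t => ramp a b t * phi t) u v = Gr v - Gr u.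
Proof.
have : Gr u + RInt (fun t => ramp a b t * phi t) u v = Gr v :=
  RInt_Chasles _ 0 u v (ex_RInt_ramp_phi _ _) (ex_RInt_ramp_phi _ _).
lra.
Qed.

Lemma is_derive_Gr x : is_derive Gr x (ramp a b x * phi x).
Proof.
apply: (is_derive_RInt (fun t => ramp a b t * phi t) Gr 0 x); last exact: ramp_phi_continuous.
by apply: filter_forall => y; apply: RInt_correct; apply: ex_RInt_ramp_phi.
Qed.

Lemma Gr_left u v : u <= v -> v <= a -> Gr v - Gr u = Ig v - Ig u.
Proof.
move=> uv va; rewrite -Gr_sub -RInt_phi; apply: RInt_ext => t.
by rewrite Rmin_left ?Rmax_right // => -[_ tv]; rewrite ramp_left; lra.
Qed.

Lemma Gr_right u v : b <= u -> u <= v -> Gr v = Gr u.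
Proof.
move=> bu uv; suff : Gr v - Gr u = 0 by lra.
rewrite -Gr_sub (RInt_ext _ (fun _ => 0)) ?RInt_const.
  by rewrite /scal /= /mult /=; ring.
by move=> t; rewrite Rmin_left ?Rmax_right // => -[tu _]; rewrite ramp_right; lra.
Qed.

Lemma Gr_incr_le u v : u <= v -> 0 <= Gr v - Gr u <= Ig v - Ig u.
Proof.
move=> uv; rewrite -Gr_sub -RInt_phi; split.
  apply: RInt_ge_0 => // [|t _]; first exact: ex_RInt_ramp_phi.
  by apply: Rmult_le_pos; [case: (ramp_bounds t) | apply: Rlt_le; apply: phi_pos].
apply: RInt_le => // [||t _]; [exact: ex_RInt_ramp_phi | exact: ex_RInt_phi|].
by have := ramp_bounds t; have := phi_pos t; nra.
Qed.

(** The ramp is constant on either side of [-Kr, Kr]; the summand 1 brings the outside into the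
    range of the Mills bounds. *)
Definition Kr : R := 1 + Rabs a + Rabs b.

Lemma Kr_props : [/\ 1 <= Kr, - Kr <= a & b <= Kr].
Proof. by rewrite /Kr; split; split_Rabs; lra. Qed.

(* The Gaussian mean of the ramp: it is 1 left of [-Kr] and 0 right of [Kr]. *)
Definition Nr : R := (Gr Kr - Gr (- Kr) + (kap - Ig Kr)) / (2 * kap).

Lemma Nr_eq : 2 * kap * Nr = Gr Kr - Gr (- Kr) + (kap - Ig Kr).
Proof. by rewrite /Nr; field; have := kap_ge1; lra. Qed.

(** The ramp lies between the indicators of the half-lines ending at [a] and at [b]. *)
Lemma Nr_bounds : Phi a <= Nr <= Phi b.
Proof.
have k1 := kap_ge1; have [K1 Ka Kb] := Kr_props.
have e1 : Gr a - Gr (- Kr) = Ig a - Ig (- Kr) by apply: Gr_left; lra.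
have [g1 _] := @Gr_incr_le a Kr ltac:(lra).
have e2 : Gr Kr = Gr b by apply: Gr_right; lra.
have [_ g2] := @Gr_incr_le (- Kr) b ltac:(lra).
have eI := Ig_odd Kr; have eN := Nr_eq.
have ePhi x : 2 * kap * Phi x = Ig x + kap by rewrite /Phi; field; lra.
by split; apply: (Rmult_le_reg_l (2 * kap)); rewrite ?ePhi ?eN; lra.
Qed.

Lemma Phi_range x : 0 <= Phi x <= 1.
Proof.
have k1 := kap_ge1; have t := Ig_tail (Rabs_pos x).
have ePhi : 2 * kap * Phi x = Ig x + kap by rewrite /Phi; field; lra.
have h : - kap <= Ig x <= kap.
  have [x0|x0] := Rle_lt_dec 0 x; first by move: t; rewrite Rabs_pos_eq //; have := Ig_incr x0; rewrite Ig0; lra.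
  by move: t; rewrite Rabs_left // Ig_odd; have := @Ig_incr x 0 ltac:(lra); rewrite Ig0; lra.
by split; apply: (Rmult_le_reg_l (2 * kap)); lra.
Qed.

(* The solution of Stein's equation F' - wF = ramp - Nr; the constant makes
   the numerator vanish at both ends. *)
Definition Gs (w : R) : R := Gr w - Nr * Ig w + (Nr * kap - Gr Kr).
Definition Fs (w : R) : R := Gs w / phi w.
Definition Fs' (w : R) : R := w * Fs w + ramp a b w - Nr.

Lemma Gs_right w : Kr <= w -> Gs w = Nr * (kap - Ig w).
Proof.
move=> Kw; have [K1 Ka Kb] := Kr_props.
by rewrite /Gs (@Gr_right Kr w) //; ring.
Qed.

Lemma Gs_left w : w <= - Kr -> Gs w = (1 - Nr) * (kap - Ig (- w)).
Proof.
move=> Kw; have [K1 Ka Kb] := Kr_props.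
have e : Gr (- Kr) - Gr w = Ig (- Kr) - Ig w by apply: Gr_left; lra.
have eN := Nr_eq; rewrite /Gs; move: e; rewrite !Ig_odd => e.
have -> : Gr w = Gr (- Kr) + Ig Kr + Ig w by lra.
lra.
Qed.

Lemma is_derive_Gs w : is_derive Gs w ((ramp a b w - Nr) * phi w).
Proof.
have h1 := is_derive_Gr w; have h2 := is_derive_Ig w.
rewrite /Gs; auto_derive; first by repeat split; eexists; eassumption.
by rewrite (is_derive_unique _ _ _ h1) (is_derive_unique _ _ _ h2); ring.
Qed.

Lemma is_derive_Fs w : is_derive Fs w (Fs' w).
Proof.
have h1 := is_derive_Gs w; have h2 := is_derive_phi w; have p := phi_pos w.
rewrite /Fs' /Fs; auto_derive; first by repeat split; try (eexists; eassumption); lra.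
by rewrite (is_derive_unique _ _ _ h1) (is_derive_unique _ _ _ h2); field; lra.
Qed.

(** The derivative of w Fs(w). Since Fs' is w Fs plus the ramp up to a constant, bounding it makes
    Fs' Lipschitz although the ramp has corners. *)
Definition kF (w : R) : R := Fs w + w * Fs' w.

Lemma is_derive_xFs w : is_derive (fun w => w * Fs w) w (kF w).
Proof.
have h := is_derive_Fs w; rewrite /kF; auto_derive; first by repeat split; eexists; eassumption.
by rewrite (is_derive_unique _ _ _ h); ring.
Qed.

Lemma Fs_continuous w : continuous Fs w.
Proof. by apply: (@ex_derive_continuous R_AbsRing R_NormedModule); eexists; apply: is_derive_Fs. Qed.

Lemma kF_continuous w : continuous kF w.
Proof.
have cid : continuous (fun w : R => w) w by apply: continuous_id.
have cF : continuous Fs w by exact: Fs_continuous.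
have cr : continuous (ramp a b) w by exact: ramp_continuous.
apply: (@continuous_plus R_UniformSpace R_AbsRing R_NormedModule) => //.
apply: (@continuous_mult R_UniformSpace R_AbsRing) => //.
apply: (@continuous_plus R_UniformSpace R_AbsRing R_NormedModule); last exact: continuous_const.
apply: (@continuous_plus R_UniformSpace R_AbsRing R_NormedModule) => //.
exact: (@continuous_mult R_UniformSpace R_AbsRing).
Qed.

Lemma Nr_range : 0 <= Nr <= 1.
Proof. by have := Nr_bounds; have := Phi_range a; have := Phi_range b; lra. Qed.

Lemma mills_bound w : 1 <= w -> 0 <= (1 + w * w) * mills w - w <= 1.
Proof.
move=> w1; have h1 := mills_lower w1; have h2 := mills_upper w1.
have m0 : 0 <= mills w by nra.
split; nra.
Qed.

Lemma kF_outside w : Kr <= Rabs w -> Rabs (kF w) <= 1.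
Proof.
have [K1 Ka Kb] := Kr_props; have [N0 N1] := Nr_range; have p := phi_pos w.
case: (Rle_lt_dec 0 w) => w0; [rewrite Rabs_pos_eq // | rewrite Rabs_left //] => Kw.
  have -> : kF w = Nr * ((1 + w * w) * mills w - w).
    by rewrite /kF /Fs' /Fs Gs_right // ramp_right ?/mills; [field|]; lra.
  by have := @mills_bound w ltac:(lra) => h; apply: Rabs_le; nra.
have -> : kF w = (1 - Nr) * ((1 + - w * - w) * mills (- w) - - w).
  rewrite /kF /Fs' /Fs Gs_left; last lra.
  by rewrite ramp_left ?/mills ?phi_even; [field|]; lra.
by have := @mills_bound (- w) ltac:(lra) => h; apply: Rabs_le; nra.
Qed.

Lemma kF_bounded : exists B, 0 <= B /\ forall w, Rabs (kF w) <= B.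
Proof.
have [K1 Ka Kb] := Kr_props.
have [M [hM _]] : exists M, (forall c, - Kr <= c <= Kr -> Rabs (kF c) <= Rabs (kF M)) /\ - Kr <= M <= Kr.
  apply: (continuity_ab_maj (fun w => Rabs (kF w))) => [|c _]; first lra.
  apply: (continuity_pt_comp kF Rabs); last exact: Rcontinuity_abs.
  by apply/continuity_pt_filterlim; apply: kF_continuous.
exists (Rabs (kF M) + 1); split=> [|w]; first by have := Rabs_pos (kF M); lra.
case: (Rle_lt_dec Kr (Rabs w)) => h; first by have := kF_outside h; have := Rabs_pos (kF M); lra.
by have := hM w ltac:(split_Rabs; lra); lra.
Qed.

Lemma Fs'_lip : exists C, 0 <= C /\ forall u v, Rabs (Fs' u - Fs' v) <= C * Rabs (u - v).
Proof.
have [B [B0 hB]] := kF_bounded; have i0 : 0 < / (b - a) by apply: Rinv_0_lt_compat; lra.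
exists (B + / (b - a)); split=> [|u v]; first lra.
have [c [_ e]] := MVT_derive v u is_derive_xFs.
have -> : Fs' u - Fs' v = kF c * (u - v) + (ramp a b u - ramp a b v) by rewrite -e /Fs'; ring.
apply: Rle_trans (Rabs_triang _ _) _; rewrite Rabs_mult.
by have := ramp_lip u v; have := hB c; have := Rabs_pos (u - v); nra.
Qed.

End Ramp.

(** * Central limit theorem for Bernoulli sums *)

Fixpoint psum (ps : seq R) : R := if ps is p :: ps' then p + psum ps' else 0.
Fixpoint pvar (ps : seq R) : R := if ps is p :: ps' then p * (1 - p) + pvar ps' else 0.

Lemma bern_mean_cons p ps g :
  bern_mean (p :: ps) g = (1 - p) * bern_mean ps g + p * bern_mean ps (fun k => g k.+1).
Proof. by []. Qed.

Lemma bern_mean_ext ps f g : (forall k, f k = g k) -> bern_mean ps f = bern_mean ps g.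
Proof. by elim: ps f g => //= p ps IH f g h; rewrite (IH f g) // (IH (fun k => f k.+1) (fun k => g k.+1)). Qed.

Lemma bern_mean_lin ps (x y : R) f g :
  bern_mean ps (fun k => x * f k + y * g k) = x * bern_mean ps f + y * bern_mean ps g.
Proof. by elim: ps f g => //= p ps IH f g; rewrite IH (IH (fun k => f k.+1) (fun k => g k.+1)); ring. Qed.

Lemma bern_mean_scal ps (x : R) f : bern_mean ps (fun k => x * f k) = x * bern_mean ps f.
Proof.
rewrite (@bern_mean_ext _ _ (fun k => x * f k + 0 * f k)); last by move=> k; ring.
by rewrite bern_mean_lin; ring.
Qed.

Lemma bern_mean_sub ps f g :
  bern_mean ps (fun k => f k - g k) = bern_mean ps f - bern_mean ps g.
Proof.
rewrite (@bern_mean_ext _ _ (fun k => 1 * f k + (- 1) * g k)); last by move=> k; ring.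
by rewrite bern_mean_lin; ring.
Qed.

Definition probs (ps : seq R) := forall p, List.In p ps -> 0 <= p <= 1.

Lemma probs_cons p ps : probs (p :: ps) -> 0 <= p <= 1 /\ probs ps.
Proof. by move=> h; split; [apply: h; left | move=> q hq; apply: h; right]. Qed.

Lemma bern_mean_le ps f g : probs ps -> (forall k, f k <= g k) ->
  bern_mean ps f <= bern_mean ps g.
Proof.
elim: ps f g => //= p ps IH f g /probs_cons[p01 hp] h.
have h1 := IH f g hp h; have h2 := IH (fun k => f k.+1) (fun k => g k.+1) hp (fun k => h k.+1).
by apply: Rplus_le_compat; apply: Rmult_le_compat_l; lra.
Qed.

Lemma bern_mean_const ps (c : R) : bern_mean ps (fun _ => c) = c.
Proof. by elim: ps => //= p ps ->; ring. Qed.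

Lemma bern_mean_abs ps f (c : R) : probs ps -> (forall k, Rabs (f k) <= c) ->
  Rabs (bern_mean ps f) <= c.
Proof.
move=> hp h; apply: Rabs_le; split.
  rewrite -(bern_mean_const ps (- c)); apply: bern_mean_le => // k.
  by have := h k; split_Rabs; lra.
rewrite -[X in _ <= X](bern_mean_const ps c); apply: bern_mean_le => // k.
by have := h k; split_Rabs; lra.
Qed.

Lemma bern_mean_INR ps : bern_mean ps INR = psum ps.
Proof.
suff h c : bern_mean ps (fun k => INR k + c) = psum ps + c.
  by rewrite -[RHS]Rplus_0_r -h; apply: bern_mean_ext => k; rewrite Rplus_0_r.
elim: ps c => //= p ps IH c; rewrite IH.
rewrite (@bern_mean_ext _ _ (fun k => INR k + (c + 1))); last first.
  by move=> k; rewrite -/(INR k.+1) S_INR; ring.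
by rewrite IH; ring.
Qed.

Lemma bern_mean_sqr ps c : bern_mean ps (fun k => (INR k + c) ^ 2) = pvar ps + (psum ps + c) ^ 2.
Proof.
elim: ps c => [|p ps IH] c; first by rewrite /=; ring.
rewrite bern_mean_cons IH (@bern_mean_ext _ _ (fun k => (INR k + (c + 1)) ^ 2)); last first.
  by move=> k; rewrite S_INR; ring.
by rewrite IH /=; ring.
Qed.

(* [d] plays the role of the derivative of [f]. *)
Lemma stein_bernoulli ps (f d : nat -> R) (C : R) : probs ps ->
  (forall k, Rabs (f k.+1 - f k - d k) <= C) ->
  (forall k, Rabs (f k.+1 - f k - d k.+1) <= C) ->
  Rabs (bern_mean ps (fun k => (INR k - psum ps) * f k) - pvar ps * bern_mean ps d) <= C * pvar ps.
Proof.
elim: ps f d => [|p ps IH] f d hp h0 h1.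
  by rewrite /= (_ : _ - _ = 0) ?Rabs_R0; [rewrite Rmult_0_r; lra | ring].
have [p01 {}hp] := probs_cons hp.
have i1 := IH f d hp h0 h1.
have i2 := IH (fun k => f k.+1) (fun k => d k.+1) hp (fun k => h0 k.+1) (fun k => h1 k.+1).
set m := psum ps in i1 i2 *; set v := pvar ps in i1 i2 *.
set D0 := bern_mean ps d in i1 *; set D1 := bern_mean ps (fun k => d k.+1) in i2 *.
set A0 := bern_mean ps (fun k => (INR k - m) * f k) in i1.
set A1 := bern_mean ps (fun k => (INR k - m) * f k.+1) in i2.
set F0 := bern_mean ps f; set F1 := bern_mean ps (fun k => f k.+1).
(* One variable is split off: its covariance with [f] is p (1 - p) times the increment [F1 - F0],
   and the rest is the induction hypothesis for [f] and its shift. *)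
have e : bern_mean (p :: ps) (fun k => (INR k - psum (p :: ps)) * f k) =
  (1 - p) * (A0 - p * F0) + p * (A1 + (1 - p) * F1).
  rewrite /= -/m; congr (_ * _ + _ * _).
    rewrite (@bern_mean_ext _ _ (fun k => 1 * ((INR k - m) * f k) + (- p) * f k)); last by move=> k; ring.
    by rewrite bern_mean_lin -/A0 -/F0; ring.
  rewrite (@bern_mean_ext _ _ (fun k => 1 * ((INR k - m) * f k.+1) + (1 - p) * f k.+1)); last first.
    by move=> k; rewrite -/(INR k.+1) S_INR; ring.
  by rewrite bern_mean_lin -/A1 -/F1; ring.
have j0 : Rabs (F1 - F0 - D0) <= C.
  by rewrite /F1 /F0 /D0 -!bern_mean_sub; apply: bern_mean_abs.
have j1 : Rabs (F1 - F0 - D1) <= C.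
  by rewrite /F1 /F0 /D1 -!bern_mean_sub; apply: bern_mean_abs.
rewrite e -[bern_mean (p :: ps) d]/((1 - p) * D0 + p * D1) -[pvar _]/(p * (1 - p) + v).
have -> : (1 - p) * (A0 - p * F0) + p * (A1 + (1 - p) * F1) -
    (p * (1 - p) + v) * ((1 - p) * D0 + p * D1) =
  ((1 - p) * (A0 - v * D0) + p * (A1 - v * D1)) +
  p * (1 - p) * ((1 - p) * (F1 - F0 - D0) + p * (F1 - F0 - D1)) by ring.
have avg x y c : Rabs x <= c -> Rabs y <= c -> Rabs ((1 - p) * x + p * y) <= c.
  move=> hx hy; apply: Rle_trans (Rabs_triang _ _) _; rewrite !Rabs_mult.
  by rewrite (Rabs_pos_eq p) ?(Rabs_pos_eq (1 - p)); nra.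
apply: Rle_trans (Rabs_triang _ _) _; rewrite Rabs_mult (Rabs_pos_eq (p * (1 - p))); last nra.
have := avg _ _ _ i1 i2; have := avg _ _ _ j0 j1.
have : 0 <= p * (1 - p) by nra.
nra.
Qed.

(** One success moves the standardised sum by 1/s, so replacing an increment of [Fs] by its
    derivative costs C/s^2. Multiplying by the variance s^2 and dividing by the scale s gives
    C/s. *)
Lemma ramp_clt a b : a < b -> exists C, 0 <= C /\ forall ps, probs ps -> 0 < pvar ps ->
  Rabs (bern_mean ps (fun k => ramp a b ((INR k - psum ps) / sqrt (pvar ps))) - Nr a b)
    <= C / sqrt (pvar ps).
Proof.
move=> ab; have [C [C0 hC]] := Fs'_lip ab; exists C; split=> // ps hp v0.
set s := sqrt (pvar ps); have s0 : 0 < s by apply: sqrt_lt_R0.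
have ss : s * s = pvar ps by apply: sqrt_sqrt; lra.
pose w k := (INR k - psum ps) / s.
have wS k : w k.+1 = w k + / s by rewrite /w S_INR; field; lra.
have is0 : 0 < / s by apply: Rinv_0_lt_compat.
have mvt k : exists c, w k <= c <= w k.+1 /\ Fs a b (w k.+1) - Fs a b (w k) = Fs' a b c * / s.
  have [c [hc e]] := MVT_derive (w k) (w k.+1) (is_derive_Fs ab).
  move: hc; rewrite e wS Rmin_left ?Rmax_right; try lra.
  by move=> hc; exists c; split=> //; congr (_ * _); ring.
have dif u v : Rabs (u - v) <= / s -> Rabs (Fs' a b u * / s - Fs' a b v / s) <= C * (/ s * / s).
  move=> h; have -> : Fs' a b u * / s - Fs' a b v / s = (Fs' a b u - Fs' a b v) * / s by field; lra.
  rewrite Rabs_mult (Rabs_pos_eq (/ s)); last lra.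
  have : Rabs (Fs' a b u - Fs' a b v) <= C * / s by apply: Rle_trans (hC u v) _; apply: Rmult_le_compat_l.
  by move=> h'; rewrite -Rmult_assoc; apply: Rmult_le_compat_r; lra.
have := @stein_bernoulli ps (fun k => Fs a b (w k)) (fun k => Fs' a b (w k) / s) (C * (/ s * / s)) hp.
have h0 k : Rabs (Fs a b (w k.+1) - Fs a b (w k) - Fs' a b (w k) / s) <= C * (/ s * / s).
  have [c [hc ->]] := mvt k; apply: dif; move: hc; rewrite wS => hc; apply: Rabs_le; lra.
have h1 k : Rabs (Fs a b (w k.+1) - Fs a b (w k) - Fs' a b (w k.+1) / s) <= C * (/ s * / s).
  have [c [hc ->]] := mvt k; apply: dif; move: hc; rewrite wS => hc; apply: Rabs_le; lra.
move=> /(_ h0 h1).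
rewrite (@bern_mean_ext _ (fun k => (INR k - psum ps) * Fs a b (w k)) (fun k => s * (w k * Fs a b (w k)))); last first.
  by move=> k; rewrite /w; field; lra.
rewrite bern_mean_scal (@bern_mean_ext _ (fun k => Fs' a b (w k) / s) (fun k => / s * Fs' a b (w k))); last first.
  by move=> k; rewrite /Rdiv Rmult_comm.
rewrite bern_mean_scal -ss.
set E1 := bern_mean ps _; set E2 := bern_mean ps _ => h.
have -> : bern_mean ps (fun k => ramp a b ((INR k - psum ps) / s)) - Nr a b = E2 - E1.
  rewrite -bern_mean_sub.
  rewrite (@bern_mean_ext _ (fun k => Fs' a b (w k) - w k * Fs a b (w k)) (fun k => ramp a b (w k) - Nr a b)).
    by rewrite bern_mean_sub bern_mean_const.
  by move=> k; rewrite /Fs'; ring.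
apply: (Rmult_le_reg_l s) => //.
have -> : s * (C / s) = C * (/ s * / s) * (s * s) by field; lra.
apply: Rle_trans h; rewrite -{1}(Rabs_pos_eq s); last lra.
rewrite -Rabs_mult Rabs_minus_sym; right; congr Rabs; field; lra.
Qed.

Definition bern_cdf (ps : seq R) (x : R) : R :=
  bern_mean ps (fun k => if Rle_dec ((INR k - psum ps) / sqrt (pvar ps)) x then 1 else 0).

Lemma bern_clt x e : 0 < e -> exists V, forall ps, probs ps -> V < pvar ps ->
  Rabs (bern_cdf ps x - Phi x) < e.
Proof.
(* One third pays for Stein's error, one for the variation of [Phi] across the ramp; the last makes
   the inequality strict. *)
move=> e0; pose dl := e / 3.
have [C1 [C10 h1]] := @ramp_clt (x - dl) x ltac:(rewrite /dl; lra).
have [C2 [C20 h2]] := @ramp_clt x (x + dl) ltac:(rewrite /dl; lra).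
pose M := 1 + (C1 + C2) / dl.
have dl0 : 0 < dl by rewrite /dl; lra.
have q0 : 0 <= (C1 + C2) / dl.
  by apply: Rmult_le_pos; [lra | apply: Rlt_le; apply: Rinv_0_lt_compat].
have M0 : 0 < M by rewrite /M; lra.
have Mdl : C1 + C2 <= M * dl by rewrite /M; have -> : (1 + (C1 + C2) / dl) * dl = dl + C1 + C2; [field|]; lra.
exists (M * M) => ps hp hV; have v0 : 0 < pvar ps by nra.
have sM : M <= sqrt (pvar ps).
  by rewrite -(sqrt_square M); [apply: sqrt_le_1_alt | ]; lra.
have {}h1 := h1 ps hp v0; have {}h2 := h2 ps hp v0.
set s := sqrt (pvar ps) in sM h1 h2.
have bound C : 0 <= C -> C <= C1 + C2 -> C / s <= dl.
  move=> c0 c1; apply: (Rmult_le_reg_r s); first lra.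
  have -> : C / s * s = C by field; lra.
  nra.
have b1 := bound C1 C10 ltac:(lra); have b2 := bound C2 C20 ltac:(lra).
have [n1 _] := @Nr_bounds (x - dl) x ltac:(lra).
have [_ n2] := @Nr_bounds x (x + dl) ltac:(lra).
have p1 := @Phi_lip (x - dl) x ltac:(lra); have p2 := @Phi_lip x (x + dl) ltac:(lra).
have l1 : bern_mean ps (fun k => ramp (x - dl) x ((INR k - psum ps) / s)) <= bern_cdf ps x.
  apply: bern_mean_le => // k; case: Rle_dec => hk /=; first by case: (ramp_bounds (x - dl) x ((INR k - psum ps) / s)); lra.
  by rewrite ramp_right; rewrite /s; lra.
have l2 : bern_cdf ps x <= bern_mean ps (fun k => ramp x (x + dl) ((INR k - psum ps) / s)).
  apply: bern_mean_le => // k; case: Rle_dec => hk /=; last by case: (ramp_bounds x (x + dl) ((INR k - psum ps) / s)); lra.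
  by rewrite ramp_left; rewrite /s; lra.
move: h1 h2 => /Rabs_le_between[h1 h1'] /Rabs_le_between[h2 h2'].
have edl : dl = e / 3 by [].
by clearbody dl; apply: Rabs_def1; lra.
Qed.

(** * Limit law *)

Lemma std_normal_cdf_Phi x : std_normal_cdf_is x (Phi x).
Proof.
have k1 := kap_ge1; have ek : sqrt (2 * PI) = 2 * kap by rewrite /kap; field.
exists (fun a => (Ig x - Ig a) / (2 * kap)); split=> [a | e e0].
  have h : Coquelicot.RInt.is_RInt gauss a x ((Ig x - Ig a) / (2 * kap)).
    have -> : (Ig x - Ig a) / (2 * kap) = scal (/ (2 * kap)) (RInt phi a x).
      by rewrite RInt_phi /scal /= /mult /=; field; lra.
    apply: (is_RInt_ext (fun t => scal (/ (2 * kap)) (phi t))).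
      by move=> t _; rewrite /gauss ek /scal /= /mult /= /phi /Rdiv Rmult_comm.
    by apply: is_RInt_scal; apply: RInt_correct; apply: ex_RInt_phi.
  have pr : Riemann_integrable gauss a x by apply: ex_RInt_Reals_0; eexists; exact: h.
  by exists pr; rewrite -RInt_Reals; apply: is_RInt_unique.
(* Beyond 2/e, the bound phi(a) a^2 <= 2 gives phi(a) < e, and the tail 2 phi(a) is divided by 2 kap
   >= 2. *)
exists (- (1 + 2 / e)) => a ha.
have q0 : 0 < 2 / e by apply: Rdiv_lt_0_compat; lra.
have qe : 2 / e * e = 2 by field; lra.
have -> : (Ig x - Ig a) / (2 * kap) - Phi x = - ((kap - Ig (- a)) / (2 * kap)).
  by rewrite /Phi Ig_odd; field; lra.
have [t0 t1] := @Ig_tail (- a) ltac:(lra).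
have i0 : 0 < / (2 * kap) by apply: Rinv_0_lt_compat; lra.
rewrite Rabs_Ropp Rabs_pos_eq; last by apply: Rmult_le_pos; lra.
apply: (Rmult_lt_reg_r (2 * kap)); first lra.
have -> : (kap - Ig (- a)) / (2 * kap) * (2 * kap) = kap - Ig (- a) by field; lra.
have h := phi_small (- a); have hp := phi_pos (- a).
have pe : phi (- a) < e.
  apply: (Rmult_lt_reg_r (- a)); first lra.
  have : 2 < e * - a by nra.
  have : phi (- a) * - a <= phi (- a) * (- a * - a) by apply: Rmult_le_compat_l; nra.
  lra.
nra.
Qed.

Section LimitLaw.
Variable L : nat -> seq (seq nat).
Hypothesis HL : forall n, uniq (L n) /\
  forall s, s \in L n <-> (size s = n /\ exists p, basis p s).

Lemma size_L n : INR (size (L n.+1)) = Sgood n.+1 (fun _ => 1).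
Proof.
rewrite -(sumR_basis n (fun _ => 1) HL) (@sumR_const _ 1) //.
by rewrite Rmult_1_r.
Qed.

Lemma meanX_L n : meanX (L n.+1) = mean_good n.
Proof. by rewrite /meanX (sumR_basis n INR HL) size_L. Qed.

(** In law, X is one sure record plus a Bernoulli sum: the mean shifts by 1, the variance and the
    standardised variable do not change. *)
Lemma L_bernoulli n : (0 < n)%N -> exists ps,
  [/\ forall p, List.In p ps -> 0 <= p <= 4 / 5,
      meanX (L n.+1) = psum ps + 1, varX (L n.+1) = pvar ps &
      forall x, cdf_normalized (L n.+1) x = bern_cdf ps x].
Proof.
move=> n0; have [ps [hp h]] := good_bernoulli n0; exists ps.
have spos := Sgood_pos n0.
have avg g : sumR (fun s => g (lrmax s)) (L n.+1) / INR (size (L n.+1)) =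
    bern_mean ps (fun k => g k.+1).
  by rewrite (sumR_basis n g HL) size_L h; field; lra.
have em : meanX (L n.+1) = psum ps + 1.
  rewrite /meanX avg -bern_mean_INR (@bern_mean_ext _ _ (fun k => 1 * INR k + 1 * 1)).
    by rewrite (@bern_mean_lin _ 1 1 INR (fun _ => 1)) bern_mean_const; ring.
  by move=> k; rewrite S_INR; ring.
have ev : varX (L n.+1) = pvar ps.
  rewrite /varX (avg (fun k => (INR k - meanX (L n.+1)) ^ 2)) em.
  rewrite (@bern_mean_ext _ _ (fun k => (INR k + - psum ps) ^ 2)) ?bern_mean_sqr; first ring.
  by move=> k; rewrite S_INR; ring.
split=> // x.
rewrite /cdf_normalized /bern_cdf.
rewrite (avg (fun k => if Rle_dec ((INR k - meanX (L n.+1)) / sqrt (varX (L n.+1))) x then 1 else 0)).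
rewrite ev em; apply: bern_mean_ext => k.
by have -> : INR k.+1 - (psum ps + 1) = INR k - psum ps by rewrite S_INR; ring.
Qed.

Lemma pvar_psum ps : (forall p, List.In p ps -> 0 <= p <= 4 / 5) -> psum ps / 5 <= pvar ps.
Proof.
elim: ps => [|p ps IH] h; first by rewrite /=; lra.
have [h0 h1] := h p (or_introl erefl).
have := IH (fun q hq => h q (or_intror hq)); rewrite /=; nra.
Qed.

Lemma ln_INR_large M : exists N, forall n, (N <= n)%coq_nat -> M < ln (INR n).
Proof.
have e0 := exp_pos M; have [N [_ hN]] := nfloor_ex (exp M) (Rlt_le _ _ e0).
exists N.+1 => n hn.
have h : exp M < INR n by have := le_INR _ _ hn; rewrite S_INR; lra.
by rewrite -(ln_exp M); apply: ln_increasing.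
Qed.

Lemma mean_limit : Un_cv (fun n => meanX (L n) / (ln (INR n) / sqrt 5)) 1.
Proof.
move=> e e0; have [N hN] := ln_INR_large (1 + 50 / e).
have q0 : 0 < 50 / e by apply: Rdiv_lt_0_compat; lra.
exists (N + 2)%N => n hn.
have l0 := hN n ltac:(lia).
(* No basis contains a permutation of length 0 or 1, so the estimates start at length 2. *)
case: n hn l0 => [|[|n]] hn l0; [lia | lia |].
rewrite meanX_L /R_dist; apply: Rle_lt_trans (mean_good_asymp (isT : (0 < n.+1)%N)) _.
apply: (Rmult_lt_reg_r (ln (INR n.+2))); first lra.
have -> : 50 / ln (INR n.+2) * ln (INR n.+2) = 50 by field; lra.
have : 50 / e * e = 50 by field; lra.
nra.
Qed.

Lemma mean_large M : exists N, forall n, (N <= n)%coq_nat -> M < meanX (L n).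
Proof.
have half : / 2 > 0 by lra.
have [N1 h1] := mean_limit half.
have [N2 h2] := ln_INR_large (1 + 5 * Rabs M).
exists (N1 + N2)%N => n hn.
have {}h2 := h2 n ltac:(lia); have {}h1 := h1 n ltac:(lia).
have h5 := s5_bounds; have M0 := Rabs_pos M; have M1 := Rle_abs M.
have l0 : 0 < ln (INR n) by lra.
move: h1; rewrite /R_dist => /Rabs_def2[_ h1].
have e : meanX (L n) = meanX (L n) / (ln (INR n) / sqrt 5) * (ln (INR n) / sqrt 5) by field; lra.
have q : 2 * Rabs M < ln (INR n) / sqrt 5.
  apply: (Rmult_lt_reg_r (sqrt 5)); first lra.
  have -> : ln (INR n) / sqrt 5 * sqrt 5 = ln (INR n) by field; lra.
  nra.
rewrite e; nra.
Qed.

Lemma cdf_limit x : Un_cv (fun n => cdf_normalized (L n) x) (Phi x).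
Proof.
move=> e e0; have [V hV] := bern_clt x e0.
(* The 1 is the sure record, and 5 undoes the factor 1/5 of [pvar_psum]. *)
have [N hN] := mean_large (1 + 5 * V).
exists (N + 2)%N => n hn; have {}hN := hN n ltac:(lia).
case: n hn hN => [|[|n]] hn hN; [lia | lia |].
have [ps [hp em ev ->]] := L_bernoulli (isT : (0 < n.+1)%N).
apply: hV => [p /hp|]; first by lra.
by have := pvar_psum hp; rewrite em in hN; lra.
Qed.

End LimitLaw.

Theorem mainTheorem10
  (L : nat -> seq (seq nat))
  (HL : forall n, uniq (L n) /\
        forall s, s \in L n <-> (size s = n /\ exists p, basis p s)) :
  Un_cv (fun n => Rdiv (meanX (L n)) (Rdiv (ln (INR n)) (sqrt (IZR 5)))) (IZR 1) /\
  (forall x : R, exists v : R, std_normal_cdf_is x v /\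
     Un_cv (fun n => cdf_normalized (L n) x) v).
Proof.
split; first exact: mean_limit.
move=> x; exists (Phi x); split; [exact: std_normal_cdf_Phi | exact: cdf_limit].
Qed.
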